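(* Let $f\colon(0,\infty)\to[0,\infty)$ be any function. Suppose $h\colon\mathbb{R}^n\to\mathbb{R}$ satisfies $h(x)\le f\big(|x|^2\big)$ for all $x\in\mathbb{R}^n\setminus\{0\}$ and is the Fourier transform of a function $g\in L^1(\mathbb{R}^n)$ such that $g(t)\ge0$ for all $t\in\mathbb{R}^n$. Then every periodic configuration in $\mathbb{R}^n$ with density $\delta$ has $f$-potential energy at least $$\delta\Big(\liminf_{t\to0}g(t)\Big)-h(0).$$
   Context: The Fourier transform of an $L^1$ function $g\colon\mathbb{R}^n\to\mathbb{R}$ is $\widehat g(t)=\int_{\mathbb{R}^n}g(x)e^{2\pi i\langle x,t\rangle}\,dx$. A periodic configuration in $\mathbb{R}^n$ is a union of finitely many translates of a lattice (of full rank), written as $\bigcup_{j=1}^N(\Lambda+v_j)$ with $\Lambda\subset\mathbb{R}^n$ a lattice and $v_j-v_k\notin\Lambda$ for $j\ne k$. Its density is the number of points per unit volume, $N/\mathrm{vol}(\mathbb{R}^n/\Lambda)$. Its $f$-potential energy is $$\frac1N\sum_{1\le j,k\le N}\ \sum_{x\in\Lambda,\ x+v_j-v_k\ne0}f\big(|x+v_j-v_k|^2\big),$$ which may be infinite; it does not depend on the choice of $\Lambda$ and $v_1,\dots,v_N$ representing the configuration. *)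

(* Defs.v *)
From HB Require Import structures.
From mathcomp Require Import all_boot all_order all_algebra.
From mathcomp Require Import complex.
From mathcomp Require Import all_classical all_reals all_analysis.

Set Implicit Arguments.
Unset Strict Implicit.
Unset Printing Implicit Defensive.

Import Order.TTheory GRing.Theory Num.Theory.
Import numFieldNormedType.Exports.

Local Open Scope classical_set_scope.
Local Open Scope ring_scope.

Section lebesgue_rV.
Variables (R : realType) (n : nat).
Implicit Type A : set 'rV[R]_n.

Definition box (a b : 'rV[R]_n) : set 'rV[R]_n :=
  [set x | forall i, a 0 i <= x 0 i < b 0 i].

Definition box_volume (a b : 'rV[R]_n) : R := \prod_i Num.max 0 (b 0 i - a 0 i).

Local Open Scope ereal_scope.

(* The covers are finite or countable: they are indexed by a subset [D] of
   [nat] because no box is empty when [n = 0]. *)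
Definition box_cover A (D : set nat) (a b : nat -> 'rV[R]_n) :=
  A `<=` \bigcup_(k in D) box (a k) (b k).

Definition lebesgue_outer A : \bar R :=
  ereal_inf [set v | exists D a b, box_cover A D a b /\
                     v = \esum_(k in D) (box_volume (a k) (b k))%:E].

Let box_volume_ge0 a b : (0 <= box_volume a b)%R.
Proof. by apply: prodr_ge0 => i _; rewrite le_max lexx. Qed.

Let lebesgue_outer0 : lebesgue_outer set0 = 0.
Proof.
apply/eqP; rewrite eq_le; apply/andP; split.
  apply: ereal_inf_lbound; exists set0, (fun=> 0%R), (fun=> 0%R).
  by rewrite esum_set0; split => // x.
apply: le_ereal_inf_tmp => _ [D [a [b [_ ->]]]].
by apply: esum_ge0 => k _; rewrite lee_fin.
Qed.

Let lebesgue_outer_ge0 A : 0 <= lebesgue_outer A.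
Proof.
apply: le_ereal_inf_tmp => _ [D [a [b [_ ->]]]].
by apply: esum_ge0 => k _; rewrite lee_fin.
Qed.

Let le_lebesgue_outer : {homo lebesgue_outer : A B / A `<=` B >-> A <= B}.
Proof.
move=> A B AB; apply: ereal_inf_le_tmp => _ [D [a [b [BD ->]]]].
by exists D, a, b; split => //; exact: subset_trans BD.
Qed.

Let lebesgue_outer_sigma_subadditive : sigma_subadditive lebesgue_outer.
Proof.
move=> A; have [[i ioo]|] := pselect (exists i, lebesgue_outer (A i) = +oo).
  rewrite (eseries_pinfty _ _ ioo) ?leey// => k _.
  by rewrite -ltNye (lt_le_trans _ (lebesgue_outer_ge0 _)).
rewrite -forallNE => Aoo.
apply/lee_addgt0Pr => e e0.
rewrite (le_trans _ (epsilon_trick _ _ (ltW e0)))//.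
pose P k (G : set nat * ((nat -> 'rV[R]_n) * (nat -> 'rV[R]_n))) :=
  box_cover (A k) G.1 G.2.1 G.2.2 /\
  \esum_(j in G.1) (box_volume (G.2.1 j) (G.2.2 j))%:E
    <= lebesgue_outer (A k) + (e / (2 ^ k.+1)%:R)%:E.
have [G PG] : {G & forall k, P k (G k)}.
  apply: (@choice _ _ P) => k.
  have fk : lebesgue_outer (A k) \is a fin_num.
    by rewrite ge0_fin_numE// ltey; apply/eqP; exact: Aoo.
  have ek : (0 < e / (2 ^ k.+1)%:R)%R by rewrite divr_gt0// ltr0n expn_gt0.
  have [_ [D [a [b [cov ->]]]] lt] := lb_ereal_inf_adherent ek fk.
  by exists (D, (a, b)); split => //; exact: ltW.
have /card_esym/ppcard_eqP[f] := card_nat2.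
pose Q : set (nat * nat) := [set: nat] `*`` (fun k => (G k).1).
pose w (p : nat * nat) : \bar R :=
  (box_volume ((G p.1).2.1 p.2) ((G p.1).2.2 p.2))%:E.
apply: (@le_trans _ _ (\esum_(p in Q) w p)).
  apply: ereal_inf_lbound; exists (f @^-1` Q),
    (fun k => (G (f k).1).2.1 (f k).2), (fun k => (G (f k).1).2.2 (f k).2).
  split.
    move=> x [k _ Akx]; have [j Dj xj] := (PG k).1 x Akx.
    by exists (f^-1%FUN (k, j)) => /=; rewrite invK ?inE.
  rewrite (reindex_esum (f @^-1` Q) Q f)//; split=> //.
  - by move=> x y _ _; apply: 'inj_f; rewrite inE.
  - by move=> p Qp; exists (f^-1%FUN p) => /=; rewrite invK ?inE.
rewrite /Q -(@esum_esum R nat nat setT (fun k => (G k).1) (fun i j => w (i, j))).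
  rewrite nneseries_esumT; last first.
    by move=> k; rewrite adde_ge0// lee_fin divr_ge0// ltW.
  by apply: le_esum => k _; exact: (PG k).2.
by move=> i j _ _; rewrite lee_fin.
Qed.

HB.instance Definition _ := isOuterMeasure.Build R 'rV[R]_n lebesgue_outer
  lebesgue_outer0 lebesgue_outer_ge0 le_lebesgue_outer
  lebesgue_outer_sigma_subadditive.

(* R^n with the sigma-algebra of Lebesgue (not only Borel) measurable sets,
   which are the Caratheodory measurable sets of the outer measure. *)
Definition lebesgue_space : measurableType _ :=
  caratheodory_type (lebesgue_outer : {outer_measure set 'rV[R]_n -> \bar R}).

Definition lebesgue_rV : {measure set lebesgue_space -> \bar R} :=
  (lebesgue_outer : {outer_measure set 'rV[R]_n -> \bar R}).

End lebesgue_rV.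

Section fourier.
Variables (R : realType) (n : nat).

Definition dot (x y : 'rV[R]_n) : R := \sum_i x 0 i * y 0 i.

Definition sqnorm (x : 'rV[R]_n) : R := dot x x.

(* e ^ (i u) *)
Definition expi (u : R) : R[i] := Complex (cos u) (sin u).

Definition cintegral d (T : measurableType d) (mu : {measure set T -> \bar R})
    (F : T -> R[i]) : R[i] :=
  Complex (\int[mu]_x complex.Re (F x)) (\int[mu]_x complex.Im (F x)).

Definition L1 (g : 'rV[R]_n -> R) : Prop :=
  (lebesgue_rV R n).-integrable setT (EFin \o g).

Definition fourier (g : 'rV[R]_n -> R) (t : 'rV[R]_n) : R[i] :=
  cintegral (lebesgue_rV R n)
    (fun x => (g x)%:C%C * expi (2 * pi * dot x t)).

End fourier.

Section periodic.
Variables (R : realType) (n : nat).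
Implicit Types (B : 'M[R]_n) (C : set 'rV[R]_n).

(* The lattice spanned over the integers by the rows of [B]; it has full rank
   when [B \in unitmx]. *)
Definition lattice B : set 'rV[R]_n :=
  [set map_mx intr z *m B | z in [set: 'rV[int]_n]].

Definition fundamental_cell B : set 'rV[R]_n :=
  [set s *m B | s in [set s : 'rV[R]_n | forall i, 0 <= s 0 i < 1]].

Definition covolume B : R := fine (lebesgue_rV R n (fundamental_cell B)).

(* A way of writing [C] as a union of translates of a lattice. Density and
   energy are computed from it; they depend only on [C]. *)
Record periodic_config C := PeriodicConfig {
  lattice_basis : 'M[R]_n ;
  lattice_basis_unit : lattice_basis \in unitmx ;
  ntrans : nat ;
  ntrans_gt0 : (0 < ntrans)%N ;
  translate : 'I_ntrans -> 'rV[R]_n ;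
  translate_distinct :
    forall j k, j != k -> ~ lattice lattice_basis (translate j - translate k) ;
  periodicE : C = \bigcup_j [set x + translate j | x in lattice lattice_basis]
}.
Arguments translate {C} p _.

Definition density C (P : periodic_config C) : R :=
  (ntrans P)%:R / covolume (lattice_basis P).

Definition energy (f : R -> R) C (P : periodic_config C) : \bar R :=
  (((ntrans P)%:R^-1)%:E *
   \sum_(j < ntrans P) \sum_(k < ntrans P)
     \esum_(x in [set x | lattice (lattice_basis P) x /\
                          (x + translate P j - translate P k != 0)%R])
       (f (sqnorm (x + translate P j - translate P k)))%:E)%E.

End periodic.

(* Main.v *)
Require Import Defs.
From mathcomp Require Import all_boot all_order all_algebra fingroup perm.
From mathcomp Require Import complex.
From mathcomp Require Import all_classical all_reals all_analysis.
From mathcomp Require Import measurable_realfun ring lra.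

(** Write e(u) for exp (2 pi i u), let B be a basis matrix of the lattice and
    v_1, ..., v_N the translates.  For any finite family of points p_a,
      sum over a, b of h (p_a - p_b) = integral of g |sum over a of e(<t, p_a>)|^2,
    a finite exchange of sum and integral ([fourier_sum_pairs]).  It is applied
    to the patch of points z B + v_j with z in {0, ..., M-1}^n, so neither
    Poisson summation nor any decay of h is involved.

    On the left, the diagonal contributes M^n N h(0).  For a fixed second index
    z', the remaining terms are bounded through h <= f by distinct terms of the
    sums that define the energy; so the left side is at most
    M^n (N * energy + N h(0)) ([patch_energy_le]).

    On the right, the exponential sum factors: with u = t B^T, its squared
    modulus is |sum over j of e(<t, v_j>)|^2 times a product of kernels
    fejer M (u_i) ([patch_point_sqmod]).  Near t = 0 the first factor is close
    to N^2 and g is at least any m below its lower limit.  The product of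
    kernels concentrates at 0: shifting u_i by the multiples of 1/M, the kernel
    has total exactly M^2 ([fejer_sum]), while each value away from the integers
    is bounded independently of M ([fejer_far]).  Cutting a period cell into
    translates of one small cell of measure 1 / (M^n |det B|) and translating
    all of them to the same place turns these finite identities into the lower
    bound m N^2 M^n / |det B|, up to a factor tending to 1
    ([fejer_mass_near0]).  Dividing by M^n N gives the statement with |det B| in
    place of the covolume.

    It remains to compare |det B| with the measures of the cells.  A linear map
    multiplies the outer measure by at most the absolute value of its
    determinant ([lebesgue_outer_linear]), and the unit cube has outer measure
    at least 1 ([lebesgue_outer_cube_ge1]); applied to a map and to its inverse,
    these two inequalities give every volume that is used. *)

Set Implicit Arguments.
Unset Strict Implicit.
Unset Printing Implicit Defensive.
Import Order.TTheory GRing.Theory Num.Theory.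
Import numFieldNormedType.Exports.
Local Open Scope classical_set_scope.
Local Open Scope ring_scope.

(** * Boxes and the Lebesgue outer measure *)

(** The error terms below are removed in this form: as a relative loss that can
    be made arbitrarily small. *)
Lemma ler_of_shrink (R : realFieldType) (c x y : R) :
  (forall e, 0 < e -> e < 1 -> x * (1 - c * e) <= y) -> x <= y.
Proof.
move=> H; rewrite leNgt; apply/negP => yx.
pose d := `|x * c| + (x - y) + 1.
have d0 : 0 < d by rewrite /d; have := normr_ge0 (x * c); lra.
have e1 : (x - y) / d / 2 < 1.
  by rewrite ltr_pdivrMr// ltr_pdivrMr// /d; have := normr_ge0 (x * c); lra.
have e0 : 0 < (x - y) / d / 2 by rewrite !divr_gt0 ?subr_gt0.
have := H _ e0 e1.
set e := _ / 2 in e0 e1 *.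
have ed : e * d * 2 = x - y by rewrite /e; field; rewrite lt0r_neq0.
have : x * c * e <= `|x * c| * e by rewrite ler_pM2r// ler_norm.
have : `|x * c| * e <= d * e by rewrite ler_pM2r// /d; lra.
by nra.
Qed.

Lemma ler_bernoulli (R : realFieldType) (x : R) n :
  0 <= x <= 1 -> 1 - n%:R * x <= (1 - x) ^+ n.
Proof.
move=> /andP[x0 x1]; elim: n => [|n IH]; first by rewrite expr0; lra.
rewrite exprS -natr1.
have n0 : 0 <= n%:R :> R by [].
have : (1 - x) * (1 - n%:R * x) <= (1 - x) * (1 - x) ^+ n.
  by rewrite ler_wpM2l// subr_ge0.
have : 0 <= n%:R * x * x by rewrite !mulr_ge0.
by nra.
Qed.

Section outer_measure.
Context (T : choiceType) (R : realType) (mu : {outer_measure set T -> \bar R}).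

Lemma outer_measure_fin (I : finType) (E : set T) (F : I -> set T) :
  (forall x, E x -> exists i, F i x) -> (mu E <= \sum_i mu (F i))%E.
Proof.
move=> EF; apply: (@le_trans _ _ (mu (\big[setU/set0]_i F i))).
  apply: le_outer_measure => x /EF[i Fi]; rewrite -bigcup_seq.
  by exists i => //=; rewrite mem_index_enum.
elim: (index_enum I) => [|i s IH]; first by rewrite !big_nil outer_measure0.
rewrite !big_cons (le_trans (outer_measureU2 _ _ _))// leeD2l//.
Qed.

(** Countable subadditivity over an arbitrary index set, as box covers are
    indexed by a subset of [nat]. *)
Lemma outer_measure_count (D : set nat) (F : nat -> set T) :
  (mu (\bigcup_(k in D) F k) <= \esum_(k in D) mu (F k))%E.
Proof.
rewrite bigcup_mkcond (le_trans (outer_measure_sigma_subadditive _ _))//.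
rewrite nneseries_esumT; last by move=> k; exact: outer_measure_ge0.
rewrite [leRHS]esum_mkcond; apply: le_esum => k _.
by case: ifP => //; rewrite outer_measure0.
Qed.

End outer_measure.

Lemma max_sub_split (R : realDomainType) (a b c : R) :
  Num.max 0 (Num.min b c - a) + Num.max 0 (b - Num.max a c) =
  Num.max 0 (b - a).
Proof.
have [bc|cb] := lerP b c; have [ac|ca] := lerP a c.
- by rewrite [X in _ + X]max_l ?addr0 ?subr_le0.
- have ba : b <= a by lra.
  by rewrite [X in _ + X]max_l ?addr0 ?subr_le0.
- rewrite !max_r ?subr_ge0//; first by ring.
  + by lra.
  + by rewrite ltW.
- by rewrite [X in X + _]max_l ?add0r ?subr_le0// ltW.
Qed.

Section boxes.
Variables (R : realType) (n : nat).
Implicit Types (E : set 'rV[R]_n) (a b : 'rV[R]_n).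
Local Notation lam := (@lebesgue_outer R n).

Lemma box_volume_ge0 a b : 0 <= box_volume a b.
Proof. by apply: prodr_ge0 => i _; rewrite le_max lexx. Qed.

Lemma box_volumeE a b : (forall i, a 0 i <= b 0 i) ->
  box_volume a b = \prod_i (b 0 i - a 0 i).
Proof. by move=> ab; apply: eq_bigr => i _; rewrite max_r// subr_ge0. Qed.

Lemma box_eq0 a b i : b 0 i <= a 0 i -> box a b = set0.
Proof.
move=> ba; rewrite -subset0 => x /(_ i)/andP[ax xb].
by have := lt_le_trans (le_lt_trans ax xb) ba; rewrite ltxx.
Qed.

Lemma lebesgue_outer_box_le a b : (lam (box a b) <= (box_volume a b)%:E)%E.
Proof.
apply: ereal_inf_lbound; exists [set 0%N], (fun=> a), (fun=> b); split.
  by move=> x bx; exists 0%N.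
by rewrite esum_set1// lee_fin box_volume_ge0.
Qed.

(** The outer measure is an infimum over box covers, so a bound on the images
    of boxes passes to the images of all sets. *)
Lemma lebesgue_outer_image_le (F : 'rV[R]_n -> 'rV[R]_n) (c : R) : 0 < c ->
  (forall a b, lam (F @` box a b) <= (c * box_volume a b)%:E)%E ->
  forall E, (lam (F @` E) <= c%:E * lam E)%E.
Proof.
move=> c0 Fbox E; rewrite -lee_pdivrMl//.
apply: le_ereal_inf_tmp => _ [D [a [b [cov ->]]]]; rewrite lee_pdivrMl//.
apply: (@le_trans _ _ (lam (\bigcup_(k in D) (F @` box (a k) (b k))))).
  apply: le_outer_measure => _ [x Ex <-].
  by have [k Dk bk] := cov x Ex; exists k => //; exists x.
apply: (le_trans (outer_measure_count _ _ _)).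
apply: (@le_trans _ _ (\esum_(k in D) (c%:E * (box_volume (a k) (b k))%:E))%E).
  by apply: le_esum => k _; rewrite (le_trans (Fbox _ _)).
have vol0 k : D k -> (0 <= (box_volume (a k) (b k))%:E)%E.
  by move=> _; rewrite lee_fin box_volume_ge0.
apply: ge_ereal_sup => _ [X [finX XD] <-].
rewrite -ge0_mule_fsumr; last by move=> k; rewrite lee_fin box_volume_ge0.
by rewrite lee_pmul2l// ereal_sup_ubound//; exists X.
Qed.

Definition set_shift E (s : 'rV[R]_n) := [set x + s | x in E].

Lemma lebesgue_outer_shift_le E s : (lam (set_shift E s) <= lam E)%E.
Proof.
rewrite -[leRHS]mul1e; apply: lebesgue_outer_image_le => // a b.
rewrite mul1r.
have -> : box_volume a b = box_volume (a + s) (b + s).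
  by apply: eq_bigr => i _; rewrite !mxE; congr (Num.max _ _); ring.
apply: le_trans (lebesgue_outer_box_le _ _); apply: le_outer_measure.
by move=> _ [x xab <-] i; have := xab i; rewrite !mxE lerD2r ltrD2r.
Qed.

Lemma lebesgue_outer_shift E s : lam (set_shift E s) = lam E.
Proof.
apply/eqP; rewrite eq_le lebesgue_outer_shift_le/=.
apply: le_trans (lebesgue_outer_shift_le (set_shift E s) (- s)).
apply: le_outer_measure => x Ex; exists (x + s); first by exists x.
by rewrite addrK.
Qed.

(** A hyperplane cuts a box into two boxes; this makes half spaces measurable. *)
Lemma box_volume_split a b i c :
  box_volume a (\row_j if j == i then Num.min (b 0 i) c else b 0 j) +
  box_volume (\row_j if j == i then Num.max (a 0 i) c else a 0 j) b =
  box_volume a b.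
Proof.
rewrite /box_volume (bigD1 i)//= [X in _ + X](bigD1 i)//= [RHS](bigD1 i)//=.
rewrite !mxE eqxx.
rewrite (eq_bigr (fun j => Num.max 0 (b 0 j - a 0 j))); last first.
  by move=> j /negPf ji; rewrite !mxE ji.
rewrite [X in _ + _ * X](eq_bigr (fun j => Num.max 0 (b 0 j - a 0 j))); last first.
  by move=> j /negPf ji; rewrite !mxE ji.
rewrite -mulrDl; congr (_ * _).
exact: max_sub_split.
Qed.

(** Splitting each box of a cover of [X] along the hyperplane yields covers of
    the two parts of [X] with the same total volume. *)
Lemma caratheodory_half_space i c :
  caratheodory_measurable (lam : {outer_measure set 'rV[R]_n -> \bar R})
    [set x : 'rV[R]_n | x 0 i < c].
Proof.
apply: le_caratheodory_measurable => X.
apply: le_ereal_inf_tmp => _ [D [a [b [cov ->]]]].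
pose b' k := \row_j if j == i then Num.min (b k 0 i) c else b k 0 j.
pose a' k := \row_j if j == i then Num.max (a k 0 i) c else a k 0 j.
rewrite (eq_esum (b := fun k => (box_volume (a k) (b' k))%:E +
   (box_volume (a' k) (b k))%:E)%E); last first.
  by move=> k _; rewrite -EFinD box_volume_split.
rewrite esumD; try by move=> k _; rewrite lee_fin box_volume_ge0.
apply: leeD; apply: ereal_inf_lbound; [exists D, a, b'|exists D, a', b]; split=> //.
  move=> x [Xx xc]; have [k Dk bk] := cov x Xx; exists k => // j.
  have := bk j; rewrite !mxE; case: eqP => // -> /andP[-> xb].
  by rewrite lt_min xb.
move=> x [Xx /negP xc]; have [k Dk bk] := cov x Xx; exists k => // j.
have := bk j; rewrite !mxE; case: eqP => // -> /andP[xa ->].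
by rewrite ge_max xa leNgt xc.
Qed.

End boxes.

(** * The unit cube has measure at least one *)

Section unit_cube.
Variable (R : realType).

(** Induction on the dimension, in place of a compactness argument.  For a fixed
    last coordinate [y] in [0, 1[, the boxes whose last side contains [y] cover
    a cube of dimension one less, so their lower dimensional volumes sum to at
    least 1; integrating this over [y] and exchanging sum and integral gives
    the volumes of the boxes.  Points are functions on [nat] of which only the
    first [n] values matter, so that the dimension can vary. *)
Lemma unit_cube_cover (n : nat) (D : set nat) (a b : nat -> nat -> R) :
  (forall x : nat -> R, (forall i, (i < n)%N -> 0 <= x i < 1) ->
     exists2 k, D k & forall i, (i < n)%N -> a k i <= x i < b k i) ->
  (1 <= \esum_(k in D) (\prod_(i < n) Num.max 0 (b k i - a k i))%:E)%E.
Proof.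
elim: n D => [|n IH] D cov.
  have [k Dk _] : exists2 k, D k &
      forall i, (i < 0)%N -> a k i <= (fun=> 0) i < b k i by exact: cov.
  apply: esum_ge; exists [set k]; first by split => // _ ->.
  by rewrite fsbig_set1 big_ord0.
pose v k := \prod_(i < n) Num.max 0 (b k i - a k i).
have v0 k : 0 <= v k by apply: prodr_ge0 => i _; rewrite le_max lexx.
pose w k := if k \in D then v k else 0.
have w0 k : 0 <= w k by rewrite /w; case: ifP.
(* [phi k y] is the lower dimensional volume of the slice of box [k] at height [y]. *)
pose I k : set (measurableTypeR R) := `[a k n, b k n[%classic.
pose mu := @lebesgue_measure R.
pose U : set (measurableTypeR R) := `[0, 1[%classic.
have mU : measurable U by exact: measurable_itv.
pose phi k (y : R) : \bar R := ((w k)%:E * (\1_(I k) y)%:E)%E.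
have phi0 k y : (0 <= phi k y)%E by rewrite mule_ge0// lee_fin.
have mI k : measurable (I k) by exact: measurable_itv.
have m1 k : @measurable_fun _ _ (measurableTypeR R) (\bar R) setT (fun y => (\1_(I k) y)%:E).
  by apply/measurable_EFinP; apply: measurable_indic; exact: mI.
have mphi k : @measurable_fun _ _ (measurableTypeR R) (\bar R) U (phi k).
  apply: measurable_funTS; apply: measurable_funeM; exact: m1.
have slice y : U y -> (1 <= \sum_(0 <= k <oo) phi k y)%E.
  rewrite /U /= in_itv/= => y01.
  have := IH (D `&` [set k | I k y]) => /(_ _)/le_trans; apply.
    move=> x x01.
    have [|k Dk xk] := cov (fun i => if (i < n)%N then x i else y).
      by move=> i _; case: ifP => // /x01.
    exists k => [|i ilt]; last by have := xk i (ltnW ilt); rewrite ilt.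
    split=> //; have := xk n (leqnn _); rewrite ltnn.
    by rewrite /I /= in_itv.
  rewrite nneseries_esumT; last by move=> k; exact: phi0.
  rewrite esum_mkcond; apply: le_esum => k _.
  rewrite in_setI; case: ifP => [/andP[kD kI]|_]; last exact: phi0.
  rewrite /phi /w kD indicE.
  by move: kI; rewrite in_setE /= => kI; rewrite mem_set// mule1.
have -> : 1%E = (\int[mu]_(y in U) 1)%E.
  rewrite integral_cst//= mul1e [RHS]lebesgue_measure_itv/= lte_fin ltr01.
  by rewrite oppr0 adde0.
have /le_trans -> // : (\int[mu]_(y in U) 1 <=
    \int[mu]_(y in U) \sum_(0 <= k <oo) phi k y)%E.
  apply: ge0_le_integral => //.
  exact: (ge0_emeasurable_sum (P := xpredT) (fun k y _ _ => phi0 k y)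
    (fun k _ => mphi k)).
rewrite integral_nneseries//.
rewrite nneseries_esumT; last by move=> k; exact: integral_ge0.
rewrite [leRHS]esum_mkcond; apply: le_esum => k _.
rewrite ge0_integralZl//; [|exact: measurable_funTS|by rewrite lee_fin].
rewrite integral_indic//.
rewrite /w; case: ifP => kD; last by rewrite mul0e.
rewrite big_ord_recr/= -/(v k) EFinM lee_wpmul2l//; first by rewrite lee_fin.
apply: (@le_trans _ _ (mu (I k))).
  have mIU : measurable (I k `&` U) by apply: measurableI => //; exact: mI.
  by apply: le_measure; [exact: mem_set|apply: mem_set; exact: mI|move=> y []].
rewrite [leLHS]lebesgue_measure_itv/= lte_fin; case: ifP => abk.
  by rewrite -EFinD lee_fin le_max lexx orbT.
by rewrite lee_fin le_max lexx.
Qed.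

Lemma lebesgue_outer_cube_ge1 n :
  (1 <= lebesgue_outer (box (0%R : 'rV[R]_n) (const_mx 1%R)))%E.
Proof.
apply: le_ereal_inf_tmp => _ [D [a [b [cov ->]]]].
pose f (u : 'rV[R]_n) (i : nat) : R := if insub i is Some j then u 0 j else 0.
have fE u (i : 'I_n) : f u i = u 0 i by rewrite /f valK.
have := @unit_cube_cover n D (f \o a) (f \o b).
under eq_esum do under eq_bigr do rewrite /= !fE.
apply=> x x01; have [|k Dk kx] := cov (\row_i x i).
  by move=> i; rewrite !mxE x01.
exists k => // i ilt; have := kx (Ordinal ilt).
by rewrite mxE -(fE (a k)) -(fE (b k)).
Qed.
End unit_cube.

(** * Triangular maps *)

Section linear_maps.
Variables (R : realType) (n : nat).
Local Notation lam := (@lebesgue_outer R n).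

(** Since [(1 + e) (1 - e) <= 1], Bernoulli's inequality turns an error factor
    [(1 + e)^m] into the shrinking factor of [ler_of_shrink]. *)
Lemma lee_of_dilate (x : \bar R) (V : R) m : (0 <= x)%E -> 0 <= V ->
  (forall e, 0 < e -> e < 1 -> (x <= ((1 + e) ^+ m * V)%:E)%E) -> (x <= V%:E)%E.
Proof.
move=> x0 V0 H; have xfin : x \is a fin_num.
  rewrite ge0_fin_numE//.
  have h0 : 0 < 2^-1 :> R by rewrite invr_gt0.
  have h1 : 2^-1 < 1 :> R by rewrite invf_lt1// ltr1n.
  exact: le_lt_trans (H _ h0 h1) (ltry _).
rewrite -(fineK xfin) lee_fin; apply: (@ler_of_shrink _ m%:R) => e e0 e1.
have := H e e0 e1; rewrite -(fineK xfin) lee_fin => xV.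
have /(ler_bernoulli m) B : 0 <= e <= 1 by rewrite !ltW.
have fx0 : 0 <= fine x by exact: fine_ge0.
apply: (@le_trans _ _ (fine x * (1 - e) ^+ m)); first by rewrite ler_wpM2l.
apply: (@le_trans _ _ ((1 + e) ^+ m * V * (1 - e) ^+ m)).
  by rewrite ler_wpM2r// exprn_ge0// subr_ge0 ltW.
rewrite mulrAC -exprMn -[leRHS]mul1r ler_wpM2r//.
rewrite exprn_ile1//; last by nra.
by rewrite mulr_ge0// ?subr_ge0 ?addr_ge0// ltW.
Qed.

(** The function [r] orders the coordinates, so that coordinate [i] of the image
    depends only on coordinate [i] and on coordinates of larger rank; both kinds
    of triangular matrices are covered.  The box is cut into cells whose side in
    direction [i] is a fraction [q^-(r i)] of the side of the box: in these units
    sides of larger rank are shorter by a factor at least [q], so for large [q]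
    the off-diagonal terms move coordinate [i] by a small fraction of its own
    side.  The image of a cell then lies in a box of volume at most
    [(1 + e)^n] times the product of the [`|T i i|] and the volume of the cell. *)
Lemma lebesgue_outer_triangular_box (T : 'M[R]_n) (r : 'I_n -> nat) :
  (forall i, T i i != 0) ->
  (forall k i, k != i -> T k i != 0 -> (r i < r k)%N) ->
  forall a b : 'rV[R]_n, (lam [set x *m T | x in box a b] <=
    (\prod_i `|T i i| * box_volume a b)%:E)%E.
Proof.
move=> T0 Tr a b.
have [[i ba]|/forallNP ab] := pselect (exists i, b 0 i <= a 0 i).
  rewrite (box_eq0 ba) image_set0 outer_measure0 lee_fin.
  by rewrite mulr_ge0 ?box_volume_ge0// prodr_ge0.
pose w i := b 0 i - a 0 i.
have w0 i : 0 < w i by rewrite subr_gt0 ltNge; apply/negP/ab.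
have -> : box_volume a b = \prod_i w i.
  by apply: box_volumeE => i; rewrite -subr_ge0; exact/ltW/w0.
rewrite -big_split/=.
have d0 i : 0 < `|T i i| by rewrite normr_gt0.
apply: (@lee_of_dilate _ _ n); first exact: outer_measure_ge0.
  by apply: prodr_ge0 => i _; rewrite mulr_ge0// ltW.
move=> e e0 e1; pose eta := e / 3.
have eta0 : 0 < eta by rewrite divr_gt0.
(* With [q >= g i], the off-diagonal terms of coordinate [i] are at most
   [eta] times the diagonal one. *)
pose g i := (\sum_k w k * `|T k i|) / (eta * `|T i i| * w i).
have g0 i : 0 <= g i.
  rewrite divr_ge0 ?sumr_ge0// => [k _|]; first by rewrite mulr_ge0// ltW.
  by rewrite ltW// !mulr_gt0.
pose q := (Num.truncn (\sum_i g i)).+1.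
have qg i : \sum_k w k * `|T k i| <= q%:R * (eta * `|T i i| * w i).
  rewrite -ler_pdivrMr ?mulr_gt0//.
  have : g i <= \sum_i g i by rewrite (bigD1 i)//= lerDl sumr_ge0.
  move/le_trans; apply; apply: ltW; apply: truncnS_gt.
pose Q i : R := (q ^ r i)%:R.
have Q0 i : 0 < Q i by rewrite ltr0n expn_gt0.
pose eps i := w i / Q i.
have eps0 i : 0 < eps i by rewrite divr_gt0.
have epsT i k : k != i -> eps k * `|T k i| <= w k * `|T k i| / (q%:R * Q i).
  move=> ki; have [->|Tki] := eqVneq (T k i) 0.
    by rewrite normr0 !mulr0 mul0r.
  rewrite /eps mulrAC ler_wpM2l ?mulr_ge0 ?(ltW (w0 k))//.
  have -> : q%:R * Q i = (q ^ (r i).+1)%:R by rewrite expnS natrM.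
  rewrite lef_pV2 ?posrE ?ltr0n ?expn_gt0// ler_nat.
  by apply: leq_pexp2l => //; exact: Tr.
have off i : \sum_(k | k != i) eps k * `|T k i| <= eta * `|T i i| * eps i.
  apply: (@le_trans _ _ ((\sum_k w k * `|T k i|) / (q%:R * Q i))).
    rewrite mulr_suml [leRHS](bigD1 i)//=.
    rewrite -[leLHS]add0r lerD//; last by apply: ler_sum => k; exact: epsT.
    by rewrite divr_ge0 ?mulr_ge0// ltW.
  rewrite ler_pdivrMr ?mulr_gt0 ?Q0 ?ltr0n//; apply: (le_trans (qg i)).
  rewrite /eps le_eqVlt; apply/orP; left; apply/eqP; field.
  exact: lt0r_neq0 (Q0 i).
(* A common bound [K] on all numbers of subdivisions lets one type
   [{ffun 'I_n -> 'I_K}] index the cells; the actual cells form the set [fam]. *)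
pose K := (\sum_i q ^ r i)%N.
have QK i : (q ^ r i <= K)%N by rewrite /K (bigD1 i)//= leq_addr.
pose fam := family (fun i (k : 'I_K) => (k < q ^ r i)%N).
pose c (f : {ffun 'I_n -> 'I_K}) : 'rV[R]_n := \row_i (a 0 i + (f i)%:R * eps i).
(* Diagonal entries may be negative, which reverses the side: hence the minimum.
   The width is [1 + 3 * eta = 1 + e] times the main term: [2 * eta] for the
   off-diagonal terms and [eta] to keep the upper bound strict. *)
pose lo f := \row_i ((c f *m T) 0 i + Num.min 0 (T i i * eps i)
   - eta * `|T i i| * eps i).
pose hi f := \row_i (lo f 0 i + (1 + e) * (`|T i i| * eps i)).
pose F f := if f \in fam then box (lo f) (hi f) else set0.
apply: (@le_trans _ _ (\sum_f lam (F f))%E).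
  apply: outer_measure_fin => _ [x xab <-].
  pose u i := (x 0 i - a 0 i) / eps i.
  have u0 i : 0 <= u i.
    by rewrite divr_ge0 ?(ltW (eps0 i))// subr_ge0; case/andP: (xab i).
  have uQ i : (Num.truncn (u i) < q ^ r i)%N.
    rewrite truncn_lt_nat// ltr_pdivrMr// -/(Q i).
    have -> : Q i * eps i = w i by rewrite /eps mulrCA mulfV ?mulr1 ?lt0r_neq0.
    by rewrite ltrD2r; case/andP: (xab i).
  pose f := [ffun i => Ordinal (leq_trans (uQ i) (QK i))].
  have ff : f \in fam by apply/familyP => i; rewrite ffunE; exact: uQ.
  exists f; rewrite /F ff => i.
  pose y k := x 0 k - c f 0 k.
  have y01 k : 0 <= y k < eps k.
    have /truncn_itv/andP[u1 u2] := u0 k.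
    rewrite /y mxE ffunE /=; move: u1 u2.
    by rewrite ler_pdivlMr// ltr_pdivrMr// -natr1; lra.
  have xT : (x *m T) 0 i = (c f *m T) 0 i + y i * T i i
      + \sum_(k | k != i) y k * T k i.
    rewrite !mxE -addrA -(bigD1 i (P := xpredT) (F := fun k => y k * T k i))//=.
    rewrite -big_split/=; apply: eq_bigr => k _.
    by rewrite -mulrDl /y addrC subrK.
  have : `|\sum_(k | k != i) y k * T k i| <= eta * `|T i i| * eps i.
    apply: le_trans (off i); apply: le_trans (ler_norm_sum _ _ _) _.
    apply: ler_sum => k ki; rewrite normrM ler_wpM2r//.
    by case/andP: (y01 k) => y1 y2; rewrite ger0_norm// ltW.
  move: xT; set S := \sum_(k | _) y k * T k i => xT.
  rewrite ler_norml => /andP[S1 S2].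
  have /andP[y1 y2] := y01 i.
  have D0 : 0 < `|T i i| * eps i by rewrite mulr_gt0.
  have [Y1 Y2] : Num.min 0 (T i i * eps i) <= y i * T i i /\
      y i * T i i <= Num.min 0 (T i i * eps i) + `|T i i| * eps i.
    have e_gt0 := eps0 i.
    have [Tp|] := boolP (0 <= T i i).
      rewrite ger0_norm//= min_l; first by split; nra.
      by rewrite mulr_ge0// ltW.
    rewrite -ltNge => Tn; rewrite ltr0_norm//= min_r; first by split; nra.
    by rewrite nmulr_rle0// ltW.
  have etaD := mulr_gt0 (mulr_gt0 eta0 (d0 i)) (eps0 i).
  have -> : hi f 0 i = lo f 0 i + `|T i i| * eps i + 3 * (eta * `|T i i| * eps i).
    by rewrite [LHS]mxE /eta; field.
  by rewrite xT [lo f 0 i]mxE; apply/andP; split; lra.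
pose v := \prod_i ((1 + e) * (`|T i i| * eps i)).
have side0 i : 0 <= (1 + e) * (`|T i i| * eps i).
  apply: mulr_ge0; first exact: addr_ge0 ler01 (ltW e0).
  exact: ltW (mulr_gt0 (d0 i) (eps0 i)).
apply: (@le_trans _ _ (\sum_f (if f \in fam then v else 0)%:E)%E).
  apply: lee_sum => f _; rewrite /F; case: ifP => _; last by rewrite outer_measure0.
  rewrite (le_trans (lebesgue_outer_box_le _ _))// lee_fin box_volumeE.
    apply: ler_prod => i _; rewrite [hi f 0 i]mxE.
    by have := side0 i; lra.
  by move=> i; rewrite [hi f 0 i]mxE lerDl; exact: side0.
rewrite sumEFin lee_fin -big_mkcond/= /v.
have := bigA_distr_big_dep (fun i (k : 'I_K) => (k < q ^ r i)%N)
  (fun i (k : 'I_K) => (1 + e) * (`|T i i| * eps i)) => <-.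
rewrite -[X in _ ^+ X]card_ord -prodr_const -big_split/=.
rewrite le_eqVlt; apply/orP; left; apply/eqP; apply: eq_bigr => i _.
rewrite -(big_ord_widen _ (fun=> (1 + e) * (`|T i i| * eps i)))// sumr_const.
rewrite card_ord -mulr_natr -/(Q i) /eps; field.
exact: lt0r_neq0 (Q0 i).
Qed.
End linear_maps.

(** * Invertible maps, covolume and dual cells *)

Section invertible_maps.
Variables (R : realType).
Local Notation lam := (@lebesgue_outer R _).

Lemma lebesgue_outer_triangular n (T : 'M[R]_n) (r : 'I_n -> nat) :
  (forall i, T i i != 0) ->
  (forall k i, k != i -> T k i != 0 -> (r i < r k)%N) ->
  forall E : set 'rV[R]_n,
    (lam [set x *m T | x in E] <= (\prod_i `|T i i|)%:E * lam E)%E.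
Proof.
move=> T0 Tr; apply: lebesgue_outer_image_le => [|a b].
  by apply: prodr_gt0 => i _; rewrite normr_gt0.
exact: lebesgue_outer_triangular_box Tr a b.
Qed.

Lemma lebesgue_outer_perm n (s : 'S_n) (E : set 'rV[R]_n) :
  (lam [set x *m perm_mx s | x in E] <= lam E)%E.
Proof.
rewrite -[leRHS]mul1e; apply: lebesgue_outer_image_le => // a b.
rewrite mul1r.
have permE (x : 'rV[R]_n) i : (x *m perm_mx s) 0 i = x 0 (s^-1%g i).
  by rewrite -[s]invgK -col_permE mxE invgK.
have -> : box_volume a b = box_volume (a *m perm_mx s) (b *m perm_mx s).
  rewrite /box_volume (reindex_inj (@perm_inj _ s^-1%g))/=.
  by apply: eq_bigr => i _; rewrite !permE.
apply: le_trans (lebesgue_outer_box_le _ _); apply: le_outer_measure.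
by move=> _ [x xab <-] i; rewrite !permE.
Qed.

(** By the decomposition into a permutation, a lower and an upper triangular
    matrix.  The opposite inequality is this one for the inverse matrix. *)
Lemma lebesgue_outer_linear n (A : 'M[R]_n) (E : set 'rV[R]_n) :
  A \in unitmx -> (lam [set x *m A | x in E] <= `|\det A|%:E * lam E)%E.
Proof.
case: n A E => [|n] A E Aunit.
  rewrite det_mx00 normr1 mul1e; apply: le_outer_measure => _ [x Ex <-].
  by rewrite (thinmx0 (x *m A)) -(thinmx0 x).
have := cormen_lup_correct A; have := cormen_lup_detL A.
have := cormen_lup_lower A; have := cormen_lup_upper A.
have := cormen_lup_perm A.
case: (cormen_lup A) => -[P L] U /= /is_perm_mxP[s ->] Uup Llow detL PA.
(* The permutation is inverted to make it the leftmost factor. *)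
have AE : A = perm_mx s^-1%g *m L *m U.
  rewrite -mulmxA -[L *m U]PA -[_ * A]/(perm_mx s *m A) mulmxA -perm_mxM mulVg.
  by rewrite perm_mx1 mul1mx.
have detA : `|\det A| = `|\det U|.
  by rewrite AE !det_mulmx detL mulr1 det_perm normrM normr_sign mul1r.
have Utrig : is_trig_mx U^T.
  by apply/is_trig_mxP => i j ij; rewrite mxE Uup.
have detU : \det U = \prod_i U i i.
  by rewrite -det_tr (det_trig Utrig); apply: eq_bigr => i _; rewrite mxE.
have U0 i : U i i != 0.
  have : \det U != 0 by rewrite -normr_eq0 -detA normr_eq0 -unitfE -unitmxE.
  by rewrite detU (bigD1 i)//= mulf_eq0 negb_or => /andP[].
have L1 i : L i i = 1 by rewrite Llow ?eqxx.
have -> : [set x *m A | x in E] = [set x *m U | x in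
    [set x *m L | x in [set x *m perm_mx s^-1%g | x in E]]].
  by rewrite !image_comp; apply: eq_imagel => x _ /=; rewrite AE !mulmxA.
rewrite detA detU normr_prod.
apply: le_trans (lebesgue_outer_triangular (r := fun i => (n - i)%N) U0 _ _) _.
  move=> k i ki Uki; have : (k <= i)%N.
    by rewrite leqNgt; apply: contra Uki => ik; rewrite Uup.
  rewrite leq_eqVlt (negPf (ki : val k != val i))/= => kj.
  have := ltn_ord i; rewrite ltnS => ilt; exact: ltn_sub2l (leq_trans kj ilt) kj.
rewrite lee_wpmul2l ?lee_fin ?prodr_ge0//.
apply: le_trans (lebesgue_outer_triangular (r := @nat_of_ord _) _ _ _) _.
- by move=> i; rewrite L1 oner_eq0.
- move=> k i ki; apply: contraR; rewrite -leqNgt => /Llow ->.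
  by rewrite (negPf ki).
- rewrite big1 ?mul1e => [|i _]; last by rewrite L1 normr1.
  exact: lebesgue_outer_perm.
Qed.

(** The unit cube is the image of the fundamental cell under [invmx B].  The cell
    also has finite measure, being the image of the unit cube under [B], so
    that [fine] keeps its value. *)
Lemma covolume_ge n (B : 'M[R]_n) : B \in unitmx -> `|\det B| <= covolume B.
Proof.
move=> Bu; have detB : 0 < `|\det B|.
  by rewrite normr_gt0 -unitfE -unitmxE.
pose cube := [set s : 'rV[R]_n | forall i, 0 <= s 0 i < 1].
have cubeE : cube = box 0 (const_mx 1).
  by apply/seteqP; split=> x xc i; have := xc i; rewrite !mxE.
have cube1 : (1 <= lam cube)%E by rewrite cubeE; exact: lebesgue_outer_cube_ge1.
have cube_fin : (lam cube <= 1)%E.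
  rewrite cubeE (le_trans (lebesgue_outer_box_le _ _))// lee_fin.
  rewrite /box_volume big1// => i _; rewrite !mxE subr0.
  by rewrite max_r.
have cell_fin : lam (fundamental_cell B) \is a fin_num.
  rewrite ge0_fin_numE; last exact: outer_measure_ge0.
  apply: le_lt_trans (lebesgue_outer_linear cube Bu) _.
  by apply: le_lt_trans (lee_wpmul2l _ cube_fin) _; rewrite ?lee_fin// mule1 ltry.
rewrite /covolume -lee_fin fineK//=.
have Biu : invmx B \in unitmx by rewrite unitmx_inv.
have := lebesgue_outer_linear (fundamental_cell B) Biu.
have -> : [set x *m invmx B | x in fundamental_cell B] = cube.
  rewrite /fundamental_cell image_comp; apply/seteqP; split => [_ [x xc <-]|x xc].
    by rewrite /= mulmxK.
  by exists x => //=; rewrite mulmxK.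
move=> /(le_trans cube1); rewrite det_inv normfV.
by rewrite muleC lee_pdivlMr// mul1e.
Qed.

(** In the coordinates [t *m B^T] dual to the basis [B], a cube of side [M^-1]
    with lowest corner [al]. *)
Definition dual_cell n (B : 'M[R]_n) (al : 'rV[R]_n) (M : R) : set 'rV[R]_n :=
  [set t | forall i, al 0 i <= (t *m B^T) 0 i < al 0 i + M^-1].

(** After a translation, [M *: B^T] maps this cell onto the unit cube. *)
Lemma lebesgue_outer_dual_cell_ge n (B : 'M[R]_n) (al : 'rV[R]_n) (M : R) :
  B \in unitmx -> 0 < M ->
  ((M ^+ n * `|\det B|)^-1%:E <= lam (dual_cell B al M))%E.
Proof.
move=> Bu M0; set P := dual_cell _ _ _.
have detB : 0 < `|\det B|.
  by rewrite normr_gt0 -unitfE -unitmxE.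
have Btu : B^T \in unitmx by rewrite unitmx_tr.
have Au : M *: B^T \in unitmx by rewrite unitmxZ// unitfE lt0r_neq0.
rewrite -(lebesgue_outer_shift P (- (al *m invmx B^T))).
set Q := set_shift _ _.
have : (lam (box (0%R : 'rV[R]_n) (const_mx 1%R)) <= lam [set x *m (M *: B^T) | x in Q])%E.
  apply: le_outer_measure => x x01; exists (M^-1 *: x *m invmx B^T); last first.
    by rewrite -scalemxAr mulmxKV// scalerA mulfV ?scale1r// lt0r_neq0.
  exists (M^-1 *: x *m invmx B^T + al *m invmx B^T); last by rewrite addrK.
  move=> i; rewrite mulmxDl !mulmxKV// !mxE lerDr addrC ltrD2l.
  have := x01 i; rewrite !mxE => /andP[x0 x1].
  by rewrite mulr_ge0 ?invr_ge0 ?(ltW M0)//= ltr_pdivrMl// mulfV// lt0r_neq0.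
move=> /(le_trans (lebesgue_outer_cube_ge1 R n)).
move=> /le_trans/(_ (lebesgue_outer_linear Q Au)).
rewrite detZ det_tr normrM normrX (gtr0_norm M0).
have c0 : 0 < M ^+ n * `|\det B| by rewrite mulr_gt0// exprn_gt0.
by rewrite -lee_pdivrMl// mule1.
Qed.

End invertible_maps.

(** * Measurable sets and translations *)

Section lebesgue_space_theory.
Variables (R : realType) (n : nat).
Local Notation lam := (lebesgue_rV R n).
Local Notation space := (lebesgue_space R n).

Lemma measurable_coord i : measurable_fun [set: space] (fun x : space => x 0 i : R).
Proof.
apply: (measurability _ (RGenInftyO.measurableE R)) => _ [_ [c ->] <-].
rewrite setTI; have -> : (fun x : space => x 0 i : R) @^-1` `]-oo, c[ =
    [set x : 'rV[R]_n | x 0 i < c].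
  by apply/seteqP; split => x; rewrite /= in_itv.
exact: caratheodory_half_space.
Qed.

Lemma measurable_dot (w : 'rV[R]_n) :
  measurable_fun [set: space] (fun x : space => dot x w).
Proof.
apply: measurable_sum => i; apply: measurable_funM; first exact: measurable_coord.
exact: measurable_cst.
Qed.

Lemma mulmx_trE (t : 'rV[R]_n) (B : 'M[R]_n) i :
  (t *m B^T) 0 i = dot t (row i B).
Proof. by rewrite mxE; apply: eq_bigr => j _; rewrite !mxE. Qed.

Lemma measurable_dual_cell (B : 'M[R]_n) al M :
  measurable (dual_cell B al M : set space).
Proof.
have -> : dual_cell B al M = \big[setI/setT]_(i : 'I_n)
    ((fun t : space => dot t (row i B)) @^-1` `[al 0 i, al 0 i + M^-1[).
  rewrite -bigcap_seq; apply/seteqP; split => t.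
    by move=> tB i _; rewrite /= in_itv/= -mulmx_trE; exact: tB.
  move=> tB i; have := tB i; rewrite /= in_itv/= -mulmx_trE; apply.
  by rewrite mem_index_enum.
apply: bigsetI_measurable => i _; rewrite -[X in measurable X]setTI.
by apply: measurable_dot => //; exact: measurable_itv.
Qed.

(** The outer measure is invariant under translations, hence so is
    Caratheodory's criterion. *)
Lemma measurable_shift (s : 'rV[R]_n) :
  measurable_fun [set: space] ((fun x => x + s) : space -> space).
Proof.
move=> _ Y mY; rewrite setTI.
have shiftE (s' : 'rV[R]_n) (X : set 'rV[R]_n) :
    set_shift X s' = (fun x => x - s') @^-1` X.
  apply/seteqP; split => [_ [x Xx <-]|x Xx]; first by rewrite /= addrK.
  by exists (x - s') => //; rewrite subrK.
have E (X : set 'rV[R]_n) : (fun x => x + s) @^-1` X = set_shift X (- s).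
  by rewrite shiftE; apply/seteqP; split => x; rewrite /= opprK.
apply: le_caratheodory_measurable => X.
have preE (Z : set 'rV[R]_n) : lebesgue_outer (X `&` (fun x => x + s) @^-1` Z) =
    lebesgue_outer (set_shift X s `&` Z).
  rewrite -(lebesgue_outer_shift (_ `&` _) s); congr lebesgue_outer.
  by apply/seteqP; split; rewrite !shiftE => x [/= Xx Yx]; split => //=;
    move: Yx; rewrite /= subrK.
have XE : lebesgue_outer X = (lebesgue_outer (set_shift X s `&` Y) +
    lebesgue_outer (set_shift X s `&` ~` Y))%E.
  by rewrite -(lebesgue_outer_shift X s); exact: mY.
by rewrite [leRHS]XE -!preE lexx.
Qed.

Lemma ge0_integral_shift (s : 'rV[R]_n) (D : set space) (F : space -> \bar R) :
  measurable D -> measurable_fun D F -> (forall x, D x -> 0 <= F x)%E ->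
  (\int[lam]_(x in D) F x =
   \int[lam]_(x in (fun x : space => (x + s)%R) @^-1` D) F (x + s)%R)%E.
Proof.
move=> mD mF F0.
rewrite -(ge0_integral_pushforward (measurable_shift s))//; last first.
  by move=> x; rewrite inE => /F0.
apply: eq_measure_integral; first exact: measurable_shift.
move=> mphi A mA _; change (lebesgue_outer A = lebesgue_outer ((fun x => x + s) @^-1` A)).
rewrite -[RHS](lebesgue_outer_shift _ s); congr lebesgue_outer.
apply/seteqP; split => [x Ax|_ [x Ax <-]//].
by exists (x - s); rewrite /= subrK.
Qed.

Lemma negligible_origin : (0 < n)%N -> lam.-negligible ([set (0 : 'rV[R]_n)] : set space).
Proof.
move=> n0; have m0 : measurable ([set (0 : 'rV[R]_n)] : set space).
  have -> : ([set (0 : 'rV[R]_n)] : set space) = \big[setI/setT]_(i : 'I_n)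
      ((fun t : space => t 0 i : R) @^-1` [set 0]).
    rewrite -bigcap_seq; apply/seteqP; split => t /=.
      by move=> -> i _; rewrite /= mxE.
    move=> t0; apply/rowP => i; rewrite mxE; apply: (t0 i).
    by rewrite /= mem_index_enum.
  apply: bigsetI_measurable => i _; rewrite -[X in measurable X]setTI.
  by apply: measurable_coord => //; exact: measurable_set1.
apply/negligibleP => //; apply/eqP; rewrite eq_le measure_ge0 andbT.
apply/lee_addgt0Pr => e e0; rewrite add0e.
pose d : R := Num.min 1 e.
have d0 : 0 < d by rewrite lt_min ltr01.
apply: (@le_trans _ _ (lebesgue_outer (box (0 : 'rV[R]_n) (const_mx d)))).
  by apply: le_outer_measure => _ -> i; rewrite !mxE lexx.
apply: le_trans (lebesgue_outer_box_le _ _) _; rewrite lee_fin.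
rewrite box_volumeE => [|i]; last by rewrite !mxE ltW.
under eq_bigr do rewrite !mxE subr0.
rewrite prodr_const card_ord; case: (n) n0 => // m _.
rewrite exprS -[leRHS]mulr1 ler_pM ?exprn_ge0 ?(ltW d0)//.
  by rewrite ge_min lexx orbT.
by rewrite exprn_ile1 ?(ltW d0)// ge_min lexx.
Qed.

End lebesgue_space_theory.

(** * Sums of exponentials and the Fejer kernel *)

Section trigonometric_sums.
Variable R : realType.
Implicit Types (z w : R[i]) (u v x : R).

Definition sqmod z : R := complex.Re z ^+ 2 + complex.Im z ^+ 2.

Lemma sqmod_ge0 z : 0 <= sqmod z. Proof. by rewrite addr_ge0 ?sqr_ge0. Qed.

Lemma sqmodM : {morph sqmod : z w / z * w}.
Proof. by move=> [a b] [c d]; rewrite /sqmod /=; ring. Qed.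

Lemma sqmod1 : sqmod 1 = 1.
Proof. by rewrite /sqmod /= expr1n expr0n addr0. Qed.

Lemma expiD u v : expi (u + v) = expi u * expi v :> R[i].
Proof.
by apply/eqP; rewrite eq_complex /= cosD sinD addrC [X in _ && (X == _)]addrC !eqxx.
Qed.

Lemma expi0 : expi 0 = 1 :> R[i].
Proof. by rewrite /expi cos0 sin0. Qed.

Lemma expi_natmul u k : expi (k%:R * u) = expi u ^+ k :> R[i].
Proof.
elim: k => [|k IH]; first by rewrite mul0r expi0 expr0.
by rewrite -natr1 mulrDl mul1r expiD IH exprSr.
Qed.

Lemma expi_2pi_nat k : expi (2 * pi * k%:R) = 1 :> R[i].
Proof.
have e1 : expi (2 * pi) = 1 :> R[i].
  by rewrite /expi [2 * pi]mulr_natl cos2pi sin2pi.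
by rewrite mulrC expi_natmul e1 expr1n.
Qed.

Lemma Re_sum (I : finType) (F : I -> R[i]) :
  complex.Re (\sum_i F i) = \sum_i complex.Re (F i).
Proof. by apply: (big_morph (@complex.Re R)) => // -[a b] [c d]. Qed.

Lemma Im_sum (I : finType) (F : I -> R[i]) :
  complex.Im (\sum_i F i) = \sum_i complex.Im (F i).
Proof. by apply: (big_morph (@complex.Im R)) => // -[a b] [c d]. Qed.

Lemma sqmod_sum_expi (I : finType) (th : I -> R) :
  sqmod (\sum_a expi (th a)) = \sum_a \sum_b cos (th a - th b).
Proof.
rewrite /sqmod Re_sum Im_sum /= !expr2 !big_distrlr -big_split /=.
apply: eq_bigr => a _; rewrite -big_split /=.
by apply: eq_bigr => b _; rewrite cosB.
Qed.

(** [M] times the usual Fejer kernel of order [M]. *)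
Definition fejer (M : nat) x := sqmod (\sum_(a < M) expi (2 * pi * (a%:R * x))).

Lemma fejer_ge0 M x : 0 <= fejer M x. Proof. exact: sqmod_ge0. Qed.

Lemma cos_2pi_neq1 x : 0 < x < 1 -> cos (2 * pi * x) != 1.
Proof.
move=> /andP[x0 x1]; have -> : 2 * pi * x = (pi * x) *+ 2 by ring.
rewrite cos_mulr2n cos2sin2.
have : 0 < sin (pi * x).
  apply: sin_gt0_pi; rewrite mulr_gt0 ?pi_gt0//=.
  by rewrite gtr_pMr ?pi_gt0.
by move=> s0; apply/eqP; nra.
Qed.

(** Real part of a geometric sum of powers of an [M]-th root of unity that
    is not 1. *)
Lemma sum_cos_roots M (a b : 'I_M) x : a != b ->
  \sum_(k < M) cos (2 * pi * (a%:R * (x + k%:R / M%:R)) -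
                    2 * pi * (b%:R * (x + k%:R / M%:R))) = 0.
Proof.
move=> ab; have M0 : (0 < M)%N by case: (M) a {ab} b => // -[].
have MR : M%:R != 0 :> R by rewrite pnatr_eq0 -lt0n.
pose phi : R := 2 * pi * ((a%:R - b%:R) / M%:R).
pose psi : R := 2 * pi * ((a%:R - b%:R) * x).
transitivity (complex.Re (\sum_(k < M) expi (psi + k%:R * phi) : R[i])).
  rewrite Re_sum; apply: eq_bigr => k _ /=; congr cos.
  by rewrite /psi /phi; field.
have -> : \sum_(k < M) expi (psi + k%:R * phi) =
    expi psi * \sum_(k < M) expi phi ^+ k :> R[i].
  by rewrite mulr_sumr; apply: eq_bigr => k _; rewrite expiD expi_natmul.
have wM : expi phi ^+ M = 1 :> R[i].
  rewrite -expi_natmul -[LHS]mulr1 -{1}(expi_2pi_nat b) -expiD.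
  have -> : M%:R * phi + 2 * pi * b%:R = 2 * pi * a%:R by rewrite /phi; field.
  exact: expi_2pi_nat.
have w1 : expi phi - 1 != 0 :> R[i].
  rewrite subr_eq0; apply/eqP => /(congr1 (@complex.Re R)) /= cosphi.
  (* The cosine is even, so the phase may be taken positive, hence in ]0, 2 pi[. *)
  wlog: a b ab @phi {psi wM} cosphi / (b < a)%N => [H|ba].
    have := ab; rewrite -(inj_eq val_inj) neq_ltn => /orP[ba|]; last exact: H.
    apply: (H b a) => //; first by rewrite eq_sym.
    by apply: etrans cosphi; rewrite -[RHS]cosN /phi -mulrN -mulNr opprB.
  have : cos (2 * pi * ((a%:R - b%:R) / M%:R)) != 1 :> R.
    apply: cos_2pi_neq1; rewrite divr_gt0 ?subr_gt0 ?ltr_nat ?ltr0n//=.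
    rewrite ltr_pdivrMr ?ltr0n// mul1r ltrBlDr.
    by rewrite (@lt_le_trans _ _ M%:R) ?ltr_nat// lerDl.
  by rewrite -/phi cosphi eqxx.
have /eqP := subrX1 (expi phi : R[i]) M.
by rewrite wM subrr eq_sym mulf_eq0 (negPf w1)/= => /eqP ->; rewrite mulr0.
Qed.

(** After expanding the square, the terms off the diagonal vanish by orthogonality
    because [M] exceeds all frequency differences; the identity is exact at
    every point [x], which makes it usable under the integral sign. *)
Lemma fejer_sum M x : (0 < M)%N ->
  \sum_(k < M) fejer M (x + k%:R / M%:R) = M%:R ^+ 2.
Proof.
move=> M0; under eq_bigr do rewrite /fejer sqmod_sum_expi.
rewrite exchange_big/=; under eq_bigr do rewrite exchange_big/=.
rewrite (eq_bigr (fun=> M%:R)) => [|a _].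
  by rewrite sumr_const card_ord expr2 mulr_natr.
rewrite (bigD1 a)//= [X in _ + X]big1 ?addr0 => [|b ba]; last first.
  by apply: sum_cos_roots; rewrite eq_sym.
rewrite (eq_bigr (fun=> 1)) => [|k _]; last by rewrite subrr cos0.
by rewrite sumr_const card_ord.
Qed.

(** The geometric sum gives
    [fejer M x * (2 - 2 * cos (2 * pi * x)) = 2 - 2 * cos (2 * pi * M * x) <= 4]. *)
Lemma fejer_far M x r : 0 < r -> r <= `|x| -> `|x| <= 2^-1 ->
  fejer M x * (1 - cos (2 * pi * r)) <= 2.
Proof.
move=> r0 rx x2; have pi0 := pi_gt0 R.
have cosx : cos (2 * pi * x) <= cos (2 * pi * r).
  have -> : cos (2 * pi * x) = cos (2 * pi * `|x|).
    by case: (ger0P x) => // _; rewrite mulrN cosN.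
  have px : pi * `|x| <= pi / 2 by rewrite ler_pM2l.
  have prx : pi * r <= pi * `|x| by rewrite ler_pM2l.
  have pr0 : 0 < pi * r by rewrite mulr_gt0.
  rewrite leNgt ltr_cos ?in_itv/= -?leNgt; first by rewrite -!mulrA ler_pM2l.
  - by apply/andP; split; lra.
  - by apply/andP; split; lra.
pose M1 : R[i] := expi (2 * pi * x) - 1.
pose S : R[i] := \sum_(a < M) expi (2 * pi * (a%:R * x)).
have MS : expi (2 * pi * (M%:R * x)) - 1 = M1 * S.
  have -> : expi (2 * pi * (M%:R * x)) = expi (2 * pi * x) ^+ M :> R[i].
    by rewrite -expi_natmul; congr expi; ring.
  rewrite subrX1; congr (_ * _); apply: eq_bigr => a _.
  by rewrite -expi_natmul; congr expi; ring.
have sqmodB1 u : sqmod (expi u - 1) = 2 - 2 * cos u.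
  by rewrite /sqmod /=; have := cos2Dsin2 u; rewrite !expr2; nra.
have := congr1 sqmod MS; rewrite sqmodM !sqmodB1 => E.
have F0 := fejer_ge0 M x; have := cos_geN1 (2 * pi * (M%:R * x)).
by rewrite -[sqmod S]/(fejer M x) in E; nra.
Qed.
End trigonometric_sums.

(** * The mass of the Fejer kernel near the origin *)

Section fejer_mass.
Variables (R : realType) (n : nat) (B : 'M[R]_n).
Hypothesis Bu : B \in unitmx.
Local Notation lam := (lebesgue_rV R n).
Local Notation space := (lebesgue_space R n).

Lemma measurable_expi_sum (I : finType) (th : I -> space -> R) :
  (forall i, measurable_fun [set: space] (th i)) ->
  measurable_fun [set: space] (fun t => sqmod (\sum_i expi (th i t))).
Proof.
move=> mth; rewrite /sqmod; under eq_fun do rewrite Re_sum Im_sum /=.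
have mcos i : measurable_fun [set: space] (fun t => cos (th i t)).
  apply: measurableT_comp (mth i).
  by apply: continuous_measurable_fun; exact: continuous_cos.
have msin i : measurable_fun [set: space] (fun t => sin (th i t)).
  apply: measurableT_comp (mth i).
  by apply: continuous_measurable_fun; exact: continuous_sin.
by apply: measurable_funD; apply: measurable_funX; exact: measurable_sum.
Qed.

Lemma measurable_fejer M (th : space -> R) :
  measurable_fun [set: space] th ->
  measurable_fun [set: space] (fun t => fejer M (th t)).
Proof.
move=> mth; apply: measurable_expi_sum => a.
by do 2 (apply: measurable_funM; first exact: measurable_cst).
Qed.

Definition fejer_prod M (t : 'rV[R]_n) : R := \prod_i fejer M ((t *m B^T) 0 i).

Lemma fejer_prod_ge0 M t : 0 <= fejer_prod M t.
Proof. by apply: prodr_ge0 => i _; exact: fejer_ge0. Qed.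

Lemma measurable_fejer_prod M : measurable_fun [set: space] (fejer_prod M).
Proof.
apply: measurable_prod => i _; apply: measurable_fejer.
by under eq_fun do rewrite mulmx_trE; exact: measurable_dot.
Qed.

(** The period cell [-1/2 <= u_i < 1/2], where [u = t *m B^T], is cut into [M^n]
    translates [Q k] of one small cell [Q0], and only those within about [r] of 0 in
    every coordinate are kept.  There [phi >= W] except perhaps at the origin, a
    null set.  After translation to [Q0] the integrands are summed pointwise;
    the set of cells kept is a product, so the sum is a product over the
    coordinates of the full total [M^2] minus at most [M] far terms,
    each at most [c]. *)
Lemma fejer_mass_near0 (M : nat) (r c : R) (phi : 'rV[R]_n -> R) (W : R) :
  (0 < n)%N -> (0 < M)%N -> 0 < r -> M%:R^-1 <= r / 2 ->
  2 <= c * (1 - cos (2 * pi * (r / 2))) -> 0 <= c <= M%:R ->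
  measurable_fun [set: space] phi -> (forall t, 0 <= phi t) -> 0 <= W ->
  (forall t, t != 0 -> (forall i, `|(t *m B^T) 0 i| <= 2 * r) -> W <= phi t) ->
  ((W * (M%:R ^+ 2 - M%:R * c) ^+ n / (M%:R ^+ n * `|\det B|))%:E <=
   \int[lam]_t (phi t * fejer_prod M t)%:E)%E.
Proof.
move=> n0 M0 r0 Mr cr /andP[c0 cM] mphi phi0 W0 Wphi.
have MR : 0 < M%:R :> R by rewrite ltr0n.
pose near1 (k : 'I_M) := `|k%:R / M%:R - 2^-1| <= r.
pose s := [seq k <- index_enum {ffun 'I_n -> 'I_M} | k \in ffun_on near1].
pose al (k : {ffun 'I_n -> 'I_M}) : 'rV[R]_n := \row_i ((k i)%:R / M%:R - 2^-1).
pose Q k : set space := dual_cell B (al k) M%:R.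
pose Q0 : set space := dual_cell B (const_mx (- 2^-1)) M%:R.
(* Translation by [sh k] adds [k / M] to the coordinates [u], so that all the
   cells [Q k] become [Q0]. *)
pose sh (k : {ffun 'I_n -> 'I_M}) := (\row_i ((k i)%:R / M%:R)) *m invmx B^T.
have Btu : B^T \in unitmx by rewrite unitmx_tr.
have shE k t i : ((t + sh k) *m B^T) 0 i = (t *m B^T) 0 i + (k i)%:R / M%:R.
  by rewrite mulmxDl mulmxKV// !mxE.
have QE k : (fun x : space => (x + sh k)%R) @^-1` Q k = Q0.
  apply/seteqP; split => t tQ i; have := tQ i; rewrite /Q /al /= shE !mxE;
    by move=> /andP[? ?]; apply/andP; split; lra.
have mQ k : measurable (Q k) by exact: measurable_dual_cell.
have mQ0 : measurable Q0 by exact: measurable_dual_cell.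
have mF : measurable_fun [set: space] (fun t => (phi t * fejer_prod M t)%:E).
  by apply/measurable_EFinP; apply: measurable_funM => //; exact: measurable_fejer_prod.
have mG : measurable_fun [set: space] (fun t => (W * fejer_prod M t)%:E).
  apply/measurable_EFinP; apply: measurable_funM; first exact: measurable_cst.
  exact: measurable_fejer_prod.
have F0 t : (0 <= (phi t * fejer_prod M t)%:E)%E.
  by rewrite lee_fin mulr_ge0 ?fejer_prod_ge0.
have G0 t : (0 <= (W * fejer_prod M t)%:E)%E.
  by rewrite lee_fin mulr_ge0 ?fejer_prod_ge0.
pose D := \big[setU/set0]_(k <- s) Q k.
have mD : measurable D by apply: bigsetU_measurable => k _.
have le_k k : k \in s -> (\int[lam]_(t in Q0) (W * fejer_prod M (t + sh k)%R)%:E <=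
    \int[lam]_(t in Q k) (phi t * fejer_prod M t)%:E)%E.
  rewrite mem_filter => /andP[/ffun_onP nk _].
  have := ge0_integral_shift (sh k) (mQ k) (measurable_funTS mG) (fun t _ => G0 t).
  rewrite QE => <-.
  apply: ae_ge0_le_integral => //; try exact: measurable_funTS.
  apply: negligibleS (negligible_origin R n0) => t /= /not_implyP[tQ tW].
  apply/eqP/negP => /negP t0; apply: tW; rewrite lee_fin ler_wpM2r ?fejer_prod_ge0//.
  apply: Wphi => // i; have := tQ i; rewrite mxE; have := nk i.
  by rewrite /near1 /in_mem /= !ler_norml => /andP[? ?] /andP[? ?]; apply/andP; split; lra.
have triv : trivIset [set` s] Q.
  apply/trivIsetP => k l _ _ kl; rewrite -subset0 => t [tk tl].
  move/eqP: kl; apply; apply/ffunP => i; apply/val_inj.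
  have := tk i; have := tl i; rewrite !mxE => /andP[l1 l2] /andP[k1 k2].
  have kM : (k i)%:R < (l i)%:R + 1 :> R.
    have : (k i)%:R / M%:R < ((l i)%:R + 1) / M%:R :> R by rewrite mulrDl mul1r; lra.
    by rewrite ltr_pM2r ?invr_gt0.
  have lM : (l i)%:R < (k i)%:R + 1 :> R.
    have : (l i)%:R / M%:R < ((k i)%:R + 1) / M%:R :> R by rewrite mulrDl mul1r; lra.
    by rewrite ltr_pM2r ?invr_gt0.
  move: kM lM; rewrite !natr1 !ltr_nat !ltnS => kl lk.
  by apply/eqP; rewrite eqn_leq kl lk.
have bound t : Q0 t -> W * (M%:R ^+ 2 - M%:R * c) ^+ n <=
    \sum_(k <- s) W * fejer_prod M (t + sh k).
  move=> tQ; rewrite -mulr_sumr ler_wpM2l// big_filter.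
  rewrite (eq_bigr (fun k : {ffun 'I_n -> 'I_M} =>
      \prod_i fejer M ((t *m B^T) 0 i + (k i)%:R / M%:R))) => [|k _]; last first.
    by apply: eq_bigr => i _; rewrite shE.
  have := bigA_distr_big near1 (fun i (k : 'I_M) =>
    fejer M ((t *m B^T) 0 i + k%:R / M%:R)) => <-.
  rewrite -[X in _ ^+ X]card_ord -prodr_const; apply: ler_prod => i _.
  apply/andP; split; first by rewrite subr_ge0 expr2 ler_wpM2l// ltW.
  rewrite -(fejer_sum ((t *m B^T) 0 i) M0) lerBlDr.
  rewrite (bigID near1)/= lerD2l.
  (* The point [x] of the cell lies within [1 / M <= r / 2] of its reference point,
     which is at distance more than [r] from 0. *)
  apply: (@le_trans _ _ (\sum_(k < M | ~~ near1 k) c)).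
    apply: ler_sum => k; rewrite /near1 -ltNge => kr.
    have := tQ i; rewrite mxE => /andP[t1 t2].
    have kM : k%:R / M%:R <= 1 - M%:R^-1 :> R.
      rewrite lerBrDr -[X in _ + X]mul1r -mulrDl ler_pdivrMr// mul1r natr1.
      by rewrite ler_nat; exact: ltn_ord.
    have k0 : 0 <= k%:R / M%:R :> R by rewrite divr_ge0.
    set x := _ + _ / _.
    have xr : r / 2 <= `|x|.
      have := ler_normD x (k%:R / M%:R - 2^-1 - x); rewrite addrC subrK.
      have : `|k%:R / M%:R - 2^-1 - x| <= M%:R^-1.
        by rewrite ler_norml /x; apply/andP; split; lra.
      by lra.
    have x2 : `|x| <= 2^-1.
      by rewrite ler_norml /x; apply/andP; split; lra.
    have r20 : 0 < r / 2 by lra.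
    have := fejer_far M r20 xr x2 => H.
    have := le_trans H cr; rewrite ler_pM2r//.
    rewrite ltNge; apply/negP => c1; have := fejer_ge0 M x; nra.
  rewrite big_mkcond/=.
  apply: (@le_trans _ _ (\sum_(k < M) c)); last by rewrite sumr_const card_ord mulr_natl.
  by apply: ler_sum => k _; case: ifP.
apply: (@le_trans _ _ (\int[lam]_(t in D) (phi t * fejer_prod M t)%:E)%E); last first.
  exact: ge0_subset_integral.
rewrite /D ge0_integral_bigsetU//; last 2 first.
- exact/filter_uniq/index_enum_uniq.
- exact: measurable_funTS.
apply: (@le_trans _ _ (\sum_(k <- s)
   \int[lam]_(t in Q0) (W * fejer_prod M (t + sh k)%R)%:E)%E); last first.
  by rewrite big_seq [leRHS]big_seq; apply: lee_sum => k; exact: le_k.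
have mGk k : measurable_fun Q0 (fun t : space => (W * fejer_prod M (t + sh k)%R)%:E).
  apply: measurable_funTS.
  exact: (measurableT_comp mG (measurable_shift (sh k))).
rewrite -ge0_integral_sum//.
have lamQ0 := lebesgue_outer_dual_cell_ge (const_mx (- 2^-1)) Bu MR.
apply: (@le_trans _ _ (\int[lam]_(t in Q0)
    (W * (M%:R ^+ 2 - M%:R * c) ^+ n)%:E)%E).
  rewrite integral_cst// EFinM lee_wpmul2l// lee_fin mulr_ge0// exprn_ge0//.
  by rewrite subr_ge0 expr2 ler_wpM2l// ltW.
apply: ge0_le_integral => //.
- by move=> t _; rewrite lee_fin mulr_ge0// exprn_ge0// subr_ge0 expr2 ler_wpM2l// ltW.
- exact: emeasurable_sum.
- by move=> t /bound; rewrite sumEFin lee_fin.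
Qed.

End fejer_mass.

(** * Fourier transforms at differences of points *)

Section pair_sums.
Variables (R : realType) (n : nat).
Local Notation lam := (lebesgue_rV R n).
Local Notation space := (lebesgue_space R n).

Lemma dotDr (t x y : 'rV[R]_n) : dot t (x + y) = dot t x + dot t y.
Proof. by rewrite -big_split; apply: eq_bigr => i _; rewrite mxE mulrDr. Qed.

Lemma dotBr (t x y : 'rV[R]_n) : dot t (x - y) = dot t x - dot t y.
Proof. by rewrite -sumrB; apply: eq_bigr => i _; rewrite !mxE mulrBr. Qed.

Lemma sqnorm_gt0 (x : 'rV[R]_n) : x != 0 -> 0 < sqnorm x.
Proof.
move=> x0; have sq i : 0 <= x 0 i * x 0 i by rewrite -expr2 sqr_ge0.
rewrite lt_neqAle sumr_ge0// andbT eq_sym; apply: contra x0 => /eqP s0.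
apply/eqP/rowP => i; rewrite mxE; apply/eqP.
have := @psumr_eq0P _ _ xpredT (fun i => x 0 i * x 0 i) (fun i _ => sq i) s0 i isT.
by move=> /eqP; rewrite mulf_eq0 orbb.
Qed.

(** As [h] is real valued, [h x] is the integral of [g] against
    [cos (2 pi <t, x>)], and the squared modulus of the sum expands into the
    cosines of the differences of the phases. *)
Lemma fourier_sum_pairs (g h : 'rV[R]_n -> R) (I : finType) (p : I -> 'rV[R]_n) :
  L1 g -> (forall x, fourier g x = (h x)%:C%C) ->
  ((\sum_a \sum_b h (p a - p b))%:E =
   \int[lam]_t (g t * sqmod (\sum_a expi (2 * pi * dot t (p a))))%:E)%E.
Proof.
move=> gL1 gh.
have mcos x : measurable_fun [set: space] (fun t : space => cos (2 * pi * dot t x)).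
  apply: (@measurableT_comp _ _ _ _ _ _ (cos : R -> R)).
    by apply: continuous_measurable_fun; exact: continuous_cos.
  by apply: measurable_funM; [exact: measurable_cst|exact: measurable_dot].
have icos x : lam.-integrable setT (fun t : space => (g t * cos (2 * pi * dot t x))%:E).
  have := integrableMl (mu := lam) measurableT gL1 (mcos x); apply.
  exists 1; split => // M M1 t _ /=.
  by apply: le_trans (ltW M1); rewrite ler_norml cos_geN1 cos_le1.
have hE x : (h x)%:E = (\int[lam]_t (g t * cos (2 * pi * dot t x))%:E)%E.
  have /(congr1 (@complex.Re R)) /= <- := gh x.
  have fin := integrable_fin_num measurableT (icos x); rewrite -(fineK fin).
  congr EFin; apply: eq_Rintegral => t _.
  by rewrite /= mul0r subr0.
have pairE : (\sum_a \sum_b h (p a - p b))%:E = (\sum_(ab : I * I)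
    \int[lam]_t (g t * cos (2 * pi * dot t (p ab.1 - p ab.2)))%:E)%E.
  rewrite pair_big/= -sumEFin; apply: eq_bigr => ab _; exact: hE.
rewrite pairE -integral_sum//; apply: eq_integral => t _.
rewrite sumEFin -mulr_sumr sqmod_sum_expi pair_big/=; congr (_ * _)%:E.
by apply: eq_bigr => ab _; rewrite dotBr mulrBr.
Qed.

Lemma esum_ge_fin (I : finType) (A : pred I) (T : choiceType) (X : set T)
    (e : I -> T) (a : T -> \bar R) :
  {in A &, injective e} -> (forall i, A i -> X (e i)) ->
  (\sum_(i | A i) a (e i) <= \esum_(x in X) a x)%E.
Proof.
move=> einj eX; have uniq_e : uniq [seq e i | i <- enum A].
  rewrite map_inj_in_uniq ?enum_uniq// => i j.
  by rewrite !mem_enum; exact: einj.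
apply: esum_ge; exists [set` [seq e i | i <- enum A]].
  split; first exact: finite_seq.
  move=> x /= xs; have [j] := mapP xs.
  by rewrite mem_enum => Aj ->; exact: eX.
by rewrite -fsbig_seq// big_map big_enum.
Qed.

Lemma continuous_sum (T : topologicalType) (I : Type) (s : seq I) (F : I -> T -> R) :
  (forall i, continuous (F i)) -> continuous (fun x => \sum_(i <- s) F i x).
Proof.
move=> cF x; elim: s => [|i s IH].
  have -> : (fun x => \sum_(i <- [::]) F i x) = cst 0.
    by apply/funext => y; rewrite big_nil.
  exact: cst_continuous.
have -> : (fun x => \sum_(j <- i :: s) F j x) =
    (fun x => F i x + \sum_(j <- s) F j x).
  by apply/funext => y; rewrite big_cons.
by apply: cvgD; [exact: cF|exact: IH].
Qed.

Lemma continuous_dot (w : 'rV[R]_n) : continuous (fun t : 'rV[R]_n => dot t w).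
Proof.
apply: continuous_sum => i x.
have ci : {for x, continuous (fun t : 'rV[R]_n => t 0 i)} by exact: coord_continuous.
have cw : {for x, continuous (fun=> w 0 i : R)} by exact: cst_continuous.
exact: (continuousM ci cw).
Qed.

Lemma sqmod_expi_sum_near0 (I : finType) (v : I -> 'rV[R]_n) (y : R) :
  y < #|I|%:R ^+ 2 ->
  \forall t \near (0 : 'rV[R]_n), y < sqmod (\sum_j expi (2 * pi * dot t (v j))).
Proof.
move=> yI; pose V (t : 'rV[R]_n) := sqmod (\sum_j expi (2 * pi * dot t (v j))).
have V0 : V 0 = #|I|%:R ^+ 2.
  rewrite /V (eq_bigr (fun=> 1)) => [|j _]; last first.
    rewrite /dot big1 ?mulr0 ?expi0// => i _; by rewrite mxE mul0r.
  rewrite /sqmod Re_sum Im_sum /= !sumr_const mul0rn.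
  by rewrite expr0n addr0.
have cV : continuous V.
  have -> : V = fun t => \sum_a \sum_b
      cos (2 * pi * dot t (v a) - 2 * pi * dot t (v b)).
    by apply/funext => t; exact: sqmod_sum_expi.
  apply: continuous_sum => a; apply: continuous_sum => b t.
  have ca w : {for t, continuous (fun t : 'rV[R]_n => 2 * pi * dot t w)}.
    have c2 : {for t, continuous (fun=> 2 * pi : R)} by exact: cst_continuous.
    exact: (continuousM c2 (@continuous_dot w t)).
  exact: (continuous_comp (continuousB (ca (v a)) (ca (v b))) (@continuous_cos R _)).
rewrite -V0 in yI; exact: (cvgr_gt _ (cV 0)).
Qed.

(** Continuity of [u *m A] at 0, with a neighbourhood given by bounds on the
    coordinates of [u], the form in which cells are described. *)
Lemma near0_mulmx (A : 'M[R]_n) (P : 'rV[R]_n -> Prop) :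
  (\forall t \near (0 : 'rV[R]_n), P t) ->
  exists2 d : R, 0 < d & forall u : 'rV[R]_n, (forall i, `|u 0 i| <= d) -> P (u *m A).
Proof.
move=> /nbhs_ballP[e /= e0 eP].
pose S := 1 + \sum_i \sum_j `|A i j|.
have S0 : 0 < S.
  by rewrite ltr_pwDl// sumr_ge0// => i _; rewrite sumr_ge0.
exists (e / 2 / S); first by rewrite !divr_gt0.
move=> u ud; apply: eP; split=> // i j; rewrite (ord1 i) !mxE /ball /= sub0r normrN.
apply: (@le_lt_trans _ _ (e / 2)); last by lra.
apply: le_trans (ler_norm_sum _ _ _) _.
apply: (@le_trans _ _ (\sum_k e / 2 / S * `|A k j|)).
  by apply: ler_sum => k _; rewrite normrM ler_wpM2r.
rewrite -mulr_sumr mulrAC ler_pdivrMr// ler_wpM2l ?divr_ge0 ?(ltW e0)//.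
rewrite /S -[leLHS]add0r lerD//; apply: ler_sum => k _.
by rewrite (bigD1 j)//= lerDl sumr_ge0.
Qed.

End pair_sums.

(** * Finite patches of a periodic configuration *)

Section lattice_points.
Variables (R : realType) (n : nat) (B : 'M[R]_n) (N M : nat).
Variable v : 'I_N -> 'rV[R]_n.
Hypothesis Bu : B \in unitmx.
Hypothesis v_distinct : forall j k, j != k -> ~ lattice B (v j - v k).
Implicit Types z : {ffun 'I_n -> 'I_M}.

Definition coeff_row z : 'rV[R]_n := \row_i (z i)%:R.
Definition patch_point (a : {ffun 'I_n -> 'I_M} * 'I_N) : 'rV[R]_n :=
  coeff_row a.1 *m B + v a.2.

Lemma coeff_row_inj : injective coeff_row.
Proof.
move=> z z' /rowP zz; apply/ffunP => i; apply/val_inj; apply/eqP.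
by have := zz i; rewrite !mxE => /eqP; rewrite eqr_nat.
Qed.

Lemma lattice_coeff_sub z z' : lattice B ((coeff_row z - coeff_row z') *m B).
Proof.
exists (\row_i ((z i : nat)%:Z - (z' i : nat)%:Z)) => //; congr (_ *m B).
by apply/rowP => i; rewrite !mxE rmorphB.
Qed.

(** The translates are distinct modulo the lattice and the basis is invertible. *)
Lemma patch_point_inj : injective patch_point.
Proof.
move=> [z j] [z' k]; rewrite /patch_point /= => E.
have vE : v j - v k = (coeff_row z' - coeff_row z) *m B.
  apply/eqP; rewrite mulmxBl subr_eq addrAC -E.
  by rewrite [_ + v j]addrC addrK.
have jk : j = k.
  apply/eqP; apply/negP => /negP /v_distinct; apply.
  by rewrite vE; exact: lattice_coeff_sub.
move: E; rewrite jk => /addIr /(can_inj (mulmxK Bu)) /coeff_row_inj -> //.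
Qed.

(** The sum over [z] of a product over the coordinates is the product of the
    one-dimensional sums. *)
Lemma patch_point_sqmod (t : 'rV[R]_n) :
  sqmod (\sum_a expi (2 * pi * dot t (patch_point a))) =
  sqmod (\sum_j expi (2 * pi * dot t (v j))) * fejer_prod B M t.
Proof.
rewrite [RHS]mulrC /fejer_prod /fejer.
have -> : \prod_i sqmod (\sum_(k < M) expi (2 * pi * (k%:R * (t *m B^T) 0 i))) =
    sqmod (\prod_i \sum_(k < M) expi (2 * pi * (k%:R * (t *m B^T) 0 i))).
  by rewrite (big_morph _ (@sqmodM R) (@sqmod1 R)).
rewrite bigA_distr_bigA /= -sqmodM; congr sqmod.
rewrite big_distrlr /= pair_big/=; apply: eq_bigr => a _.
have dotE : dot t (coeff_row a.1 *m B) = \sum_i (a.1 i)%:R * (t *m B^T) 0 i.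
  rewrite /dot; under eq_bigr do rewrite mxE mulr_sumr.
  rewrite exchange_big /=; apply: eq_bigr => i _.
  rewrite [(t *m B^T) 0 i]mxE mulr_sumr; apply: eq_bigr => j _; rewrite !mxE; ring.
rewrite dotDr mulrDr expiD dotE; congr (_ * _).
rewrite -(big_morph _ (@expiD R) (expi0 R)) /=; congr expi.
by rewrite mulr_sumr.
Qed.

(** [N] times the energy. *)
Definition lattice_pair_sum (f : R -> R) : \bar R :=
  (\sum_(j < N) \sum_(k < N)
     \esum_(x in [set x | lattice B x /\ (x + v j - v k != 0)%R])
       (f (sqnorm (x + v j - v k)))%:E)%E.

(** For fixed [z'], [j] and [k], the map sending [z] to [(z - z') B] is injective into
    the lattice, so the terms with first index [(z, j)] and second index [(z', k)]
    form part of the inner sum of the energy; the number of choices of [z'] is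
    [M^n]. *)
Lemma patch_energy_le (f : R -> R) (h : 'rV[R]_n -> R) :
  (forall x, x != 0 -> h x <= f (sqnorm x)) ->
  ((\sum_a \sum_b h (patch_point a - patch_point b) - (M ^ n * N)%:R * h 0)%:E <=
   (M ^ n)%:R%:E * lattice_pair_sum f)%E.
Proof.
move=> hf.
have diag : \sum_a \sum_b h (patch_point a - patch_point b) - (M ^ n * N)%:R * h 0 =
    \sum_b \sum_(a | a != b) h (patch_point a - patch_point b).
  rewrite exchange_big /=.
  rewrite (eq_bigr (fun b => h 0 + \sum_(a | a != b) h (patch_point a - patch_point b))).
    rewrite big_split /= sumr_const card_prod card_ffun !card_ord mulr_natl.
    by rewrite [LHS]addrC addKr.
  by move=> b _; rewrite (bigD1 b)//= subrr.
have pp0 a b : a != b -> patch_point a - patch_point b != 0.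
  by rewrite subr_eq0; apply: contra_neq; exact: patch_point_inj.
have shape z z' j k : patch_point (z, j) - patch_point (z', k) =
    (coeff_row z - coeff_row z') *m B + v j - v k.
  by rewrite /patch_point /= mulmxBl opprD addrACA !addrA.
have block z' : ((\sum_k \sum_(a | a != (z', k))
    h (patch_point a - patch_point (z', k)))%:E <= lattice_pair_sum f)%E.
  rewrite /lattice_pair_sum exchange_big /= -sumEFin; apply: lee_sum => k _.
  have -> : \sum_(a | a != (z', k)) h (patch_point a - patch_point (z', k)) =
      \sum_j \sum_(z | (z, j) != (z', k)) h (patch_point (z, j) - patch_point (z', k)).
    by rewrite (exchange_big_dep xpredT) //= pair_big_dep /=; apply: eq_big => -[].
  rewrite -sumEFin; apply: lee_sum => j _; rewrite -sumEFin.
  apply: (@le_trans _ _ (\sum_(z | (z, j) != (z', k))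
      (f (sqnorm ((coeff_row z - coeff_row z') *m B + v j - v k)))%:E)%E).
    by apply: lee_sum => z /pp0 zz; rewrite lee_fin -shape; exact: hf.
  apply: (@esum_ge_fin _ _ _ _ _ (fun z => (coeff_row z - coeff_row z') *m B)
      (fun x => (f (sqnorm (x + v j - v k)))%:E)).
    by move=> z1 z2 _ _ /(can_inj (mulmxK Bu)) /addIr /coeff_row_inj.
  move=> z zz; split; first exact: lattice_coeff_sub.
  by rewrite -shape; exact: pp0.
rewrite diag; have -> : \sum_b \sum_(a | a != b) h (patch_point a - patch_point b) =
    \sum_z' \sum_k \sum_(a | a != (z', k)) h (patch_point a - patch_point (z', k)).
  by rewrite pair_big /=; apply: eq_bigr => -[].
rewrite -sumEFin.
apply: (@le_trans _ _ (\sum_(z' : {ffun 'I_n -> 'I_M}) lattice_pair_sum f)%E).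
  by apply: lee_sum => z' _; exact: block.
rewrite big_const card_ffun !card_ord le_eqVlt; apply/orP; left; apply/eqP.
elim: (M ^ n)%N => [|m IH]; first by rewrite mul0e.
by rewrite iterS IH -add1n natrD EFinD ge0_muleDl ?lee_fin// mul1e.
Qed.
End lattice_points.

(** * The lower bound on the energy *)

(** The inequality for a fixed lower bound [m] of [g] near 0.  The error
    [e] is spent twice, on [|sum over j of e(<t, v_j>)|^2 >= N^2 (1 - e)] near 0 and on
    the Fejer mass, whose relative loss is at most [n c / M] by Bernoulli's
    inequality; hence the factor [1 - 2 e]. *)
Lemma pair_sum_ge (R : realType) (n N : nat) (B : 'M[R]_n)
    (v : 'I_N -> 'rV[R]_n) (f : R -> R) (g h : 'rV[R]_n -> R) (m tau : R) :
  (0 < n)%N -> (0 < N)%N -> B \in unitmx ->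
  (forall j k, j != k -> ~ lattice B (v j - v k)) ->
  (forall x, x != 0 -> h x <= f (sqnorm x)) -> L1 g ->
  (forall x, fourier g x = (h x)%:C%C) -> (forall t, 0 <= g t) ->
  lattice_pair_sum B v f = tau%:E ->
  0 <= m -> (\forall t \near (0 : 'rV[R]_n), t != 0 -> m <= g t) ->
  m * N%:R ^+ 2 / `|\det B| <= tau + N%:R * h 0.
Proof.
move=> n0 N0 Bu vd hf gL1 gh g0 tauE m0 gm.
have D0 : 0 < `|\det B| by rewrite normr_gt0 -unitfE -unitmxE.
have NR : 0 < N%:R :> R by rewrite ltr0n.
apply: (@ler_of_shrink _ 2) => e e0 e1.
pose V t := sqmod (\sum_j expi (2 * pi * dot t (v j))).
have NV : N%:R ^+ 2 * (1 - e) < #|'I_N|%:R ^+ 2 :> R.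
  by rewrite card_ord -[ltRHS]mulr1 ltr_pM2l ?exprn_gt0//; lra.
have nearV := sqmod_expi_sum_near0 v NV.
pose W := m * (N%:R ^+ 2 * (1 - e)).
have W0 : 0 <= W by rewrite !mulr_ge0 ?sqr_ge0// subr_ge0 ltW.
pose phi t := g t * V t.
have phi0 t : 0 <= phi t by rewrite mulr_ge0// sqmod_ge0.
have nearphi : \forall t \near (0 : 'rV[R]_n), t != 0 -> W <= phi t.
  near=> t => t0; rewrite ler_pM ?mulr_ge0 ?sqr_ge0 ?subr_ge0 ?(ltW e1)//.
    by move: t0; near: t.
  by apply: ltW; near: t.
have [d d0 dphi] := near0_mulmx (invmx B^T) nearphi.
(* The bound [r <= 1] keeps [r / 2] off the integers, so that [q > 0] below. *)
pose r := Num.min (d / 2) 1.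
have r0 : 0 < r by rewrite lt_min ltr01 divr_gt0.
have rd : 2 * r <= d.
  have : r <= d / 2 by rewrite ge_min lexx.
  by lra.
have r1 : r <= 1 by rewrite ge_min lexx orbT.
pose q := 1 - cos (2 * pi * (r / 2)).
have q0 : 0 < q.
  rewrite subr_gt0 lt_neqAle cos_le1 andbT; apply: cos_2pi_neq1.
  by apply/andP; split; lra.
pose c := 2 / q.
have c0 : 0 < c by rewrite divr_gt0.
(* Three requirements on [M]: cells smaller than [r / 2], a nonnegative
   one-dimensional mass, and a relative loss of at most [e]. *)
pose Mb := 2 / r + c + n%:R * c / e.
pose M := (Num.truncn Mb).+1.
have MM : Mb < M%:R by apply: truncnS_gt.
have [b1 b2 b3] : [/\ 0 < 2 / r, 0 <= n%:R * c / e & 0 < M%:R :> R].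
  split; [exact: divr_gt0|exact: divr_ge0 (mulr_ge0 (ler0n _ _) (ltW c0)) (ltW e0)|
    by rewrite ltr0n].
have Mr : M%:R^-1 <= r / 2.
  rewrite -[leRHS]invrK lef_pV2 ?posrE ?invr_gt0 ?divr_gt0//.
  by rewrite invf_div; rewrite /Mb in MM; lra.
have cM : 0 <= c <= M%:R by apply/andP; split; rewrite /Mb in MM; lra.
have cq : 2 <= c * q by rewrite /c divfK ?lexx ?lt0r_neq0.
have mg : measurable_fun [set: lebesgue_space R n] g.
  by apply/measurable_EFinP; exact: measurable_int gL1.
have mphi : measurable_fun [set: lebesgue_space R n] phi.
  apply: measurable_funM => //; apply: measurable_expi_sum => j.
  by apply: measurable_funM; [exact: measurable_cst|exact: measurable_dot].
have Wphi t : t != 0 -> (forall i, `|(t *m B^T) 0 i| <= 2 * r) -> W <= phi t.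
  move=> t0 tr; have := dphi (t *m B^T); rewrite mulmxK ?unitmx_tr//; apply=> //.
  by move=> i; exact: le_trans (tr i) rd.
have := fejer_mass_near0 Bu n0 (ltn0Sn _) r0 Mr cq cM mphi phi0 W0 Wphi.
have -> : (\int[lebesgue_rV R n]_t (phi t * fejer_prod B M t)%:E =
    (\sum_a \sum_b h (patch_point (M := M) B v a - patch_point (M := M) B v b))%:E)%E.
  rewrite (fourier_sum_pairs _ gL1 gh); apply: eq_integral => t _.
  by rewrite patch_point_sqmod mulrA.
have := @patch_energy_le R n B N M v Bu vd f h hf.
rewrite tauE -EFinM !lee_fin => up low.
have Mn : 0 < M%:R ^+ n :> R by rewrite exprn_gt0.
have {up low} : W * (M%:R ^+ 2 - M%:R * c) ^+ n / (M%:R ^+ n * `|\det B|) <=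
    M%:R ^+ n * (tau + N%:R * h 0).
  by apply: (le_trans low); move: up; rewrite natrM natrX; lra.
(* Both bounds carry a factor [M^n], which cancels. *)
have -> : M%:R ^+ 2 - M%:R * c = M%:R * M%:R * (1 - c / M%:R).
  by field; rewrite lt0r_neq0.
rewrite !exprMn.
have -> : W * (M%:R ^+ n * M%:R ^+ n * (1 - c / M%:R) ^+ n) /
    (M%:R ^+ n * `|\det B|) = M%:R ^+ n * (W * (1 - c / M%:R) ^+ n / `|\det B|).
  by field; rewrite !lt0r_neq0.
rewrite ler_pM2l//; apply: le_trans.
have cM01 : 0 <= c / M%:R <= 1.
  by case/andP: cM => ? ?; rewrite divr_ge0//= ler_pdivrMr// mul1r.
have := ler_bernoulli n cM01.
have : n%:R * (c / M%:R) <= e.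
  rewrite mulrA ler_pdivrMr// [e * _]mulrC -ler_pdivrMr//; rewrite /Mb in MM; lra.
move=> ne B1; have B2 : 1 - e <= (1 - c / M%:R) ^+ n by lra.
rewrite mulrAC ler_pM2r ?invr_gt0//.
apply: (@le_trans _ _ (W * (1 - e))); last by rewrite ler_wpM2l.
rewrite /W -!mulrA ler_wpM2l// ler_wpM2l ?sqr_ge0//; nra.
Unshelve. all: by end_near.
Qed.

Theorem proposition9p3 (R : realType) (n : nat) (n_gt0 : (0 < n)%N)
  (f : R -> R) (f_ge0 : forall r : R, 0 < r -> 0 <= f r)
  (h g : 'rV[R]_n -> R)
  (h_le_f : forall x : 'rV[R]_n, x != 0 -> h x <= f (sqnorm x))
  (g_L1 : L1 g)
  (h_fourier : forall x : 'rV[R]_n, fourier g x = (h x)%:C%C)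
  (g_ge0 : forall t : 'rV[R]_n, 0 <= g t)
  (C : set 'rV[R]_n) (P : periodic_config C) :
  ((density P)%:E * limf_einf (fun t : 'rV[R]_n => (g t)%:E) (0%R : 'rV[R]_n)^'
     - (h 0%R)%:E <= energy f P)%E.
Proof.
case: P => B Bu N N0 v vd CE.
have -> : density (PeriodicConfig Bu N0 vd CE) = N%:R / covolume B by [].
have -> : energy f (PeriodicConfig Bu N0 vd CE) =
  ((N%:R^-1)%:E * lattice_pair_sum B v f)%E by [].
have NR : 0 < N%:R :> R by rewrite ltr0n.
have D0 : 0 < `|\det B| by rewrite normr_gt0 -unitfE -unitmxE.
have covD := covolume_ge Bu.
have cov0 : 0 < covolume B by exact: lt_le_trans covD.
have T0 : (0 <= lattice_pair_sum B v f)%E.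
  apply: sume_ge0 => j _; apply: sume_ge0 => k _.
  by apply: esum_ge0 => x [_ x0]; rewrite lee_fin f_ge0// sqnorm_gt0.
case tauE : (lattice_pair_sum B v f) T0 => [tau| |]// _; last first.
  by rewrite gt0_muley ?leey// lte_fin invr_gt0.
have delta0 : 0 < N%:R / covolume B by rewrite divr_gt0.
rewrite leeBlDr// -EFinM -EFinD -lee_pdivlMl//; set K := (X in (_ <= X%:E)%E).
have Km m : 0 <= m -> (\forall t \near (0 : 'rV[R]_n)^', m <= g t) -> m <= K.
  move=> m0 gm.
  have := pair_sum_ge n_gt0 N0 Bu vd h_le_f g_L1 h_fourier g_ge0 tauE m0 gm.
  move=> core; rewrite /K ler_pdivlMl//.
  have -> : N%:R^-1 * tau + h 0 = N%:R^-1 * (tau + N%:R * h 0).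
    by field; rewrite lt0r_neq0.
  rewrite ler_pdivlMl//; apply: le_trans core.
  have -> : N%:R * (N%:R / covolume B * m) = m * N%:R ^+ 2 / covolume B by ring.
  by rewrite ler_wpM2l ?mulr_ge0 ?sqr_ge0// lef_pV2 ?posrE.
rewrite limf_einfE; apply: ge_ereal_sup => _ [A A0 <-].
have infA m : (m%:E <= ereal_inf [set (g t)%:E | t in A])%E ->
    \forall t \near (0 : 'rV[R]_n)^', m <= g t.
  move=> mA; apply: filterS A0 => t At; rewrite -lee_fin.
  by apply: le_trans mA _; apply: ereal_inf_lbound; exists t.
have : (0 <= ereal_inf [set (g t)%:E | t in A])%E.
  by apply: le_ereal_inf_tmp => _ [t _ <-]; rewrite lee_fin.
case iE : (ereal_inf _) infA => [m| |]// infA m0.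
  by rewrite lee_fin; apply: Km => //; apply: infA.
(* A finite energy bounds every such [m], so the lower limit cannot be infinite. *)
exfalso; have := Km (`|K| + 1) (addr_ge0 (normr_ge0 _) ler01) (infA _ (leey _)).
by have := ler_norm K; lra.
Qed.
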